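(* Let $A$ be a set and let $F_A:=\Omega(\mathsf{hcolim}(A\rightrightarrows\mathbf 1))$ be the free higher group on $A$. Then for every $x:F_A$ the fundamental group $\pi(F_A,x):=\|x=_{F_A}x\|_0$ is trivial, i.e. equivalent to the unit type $\mathbf 1$.
   Context: Homotopy type theory setting. $\mathsf{hcolim}(A\rightrightarrows\mathbf 1)$ (the wedge of $A$-many circles) is the higher inductive type with constructors $\mathsf{base}:\mathsf{hcolim}(A\rightrightarrows\mathbf 1)$ and $\mathsf{loop}:A\to\mathsf{base}=\mathsf{base}$; its loop space is $\Omega(\mathsf{hcolim}(A\rightrightarrows\mathbf 1)):=(\mathsf{base}=\mathsf{base})$. $\|-\|_0$ denotes set-truncation. *)

(* Defs.v *)
From Stdlib Require Import List.
Import ListNotations.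

(* Rocq's own equality cannot play the role of the identity type of homotopy
   type theory: it satisfies UIP as soon as Prop is proof irrelevant.
   Homotopy type theory is therefore an object theory here, and a theorem of
   homotopy type theory is a type with a closed term.

   The formal system is that of the appendix of the HoTT Book, in the style of
   its first presentation: lambda terms without domain annotations, primitive
   constants, untyped convertibility, and cumulative universes a la Russell.
   It has the types 0, 1, N, +, Pi, Sigma and Id, judgmental eta for Pi,
   function extensionality, univalence, and as higher inductive types all
   homotopy coequalizers, all wedges of circles, and all n-truncations. *)

(* The argument of [Trunc], [tr], [istrunc] and [indTrunc] is the truncation
   level shifted by two: k = n + 2 stands for the n-truncation. *)
Inductive cst : Type :=
| Zero | indZero
| One | star | indOne
| Nat | zero | succ | indNat
| Sum | inl | inr | indSum
| Sigma | pair | indSigma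
| Id | refl | J
| funext | univalence
| Coeq | inj | glue | indCoeq | indCoeq_glue
| Wedge | base | loop | indWedge | indWedge_loop
| Trunc (k : nat) | tr (k : nat) | istrunc (k : nat) | indTrunc (k : nat).

Inductive tm : Type :=
| Var (n : nat)
| Univ (i : nat)
| Pi (A B : tm)          (* binds one variable in B *)
| Lam (t : tm)           (* binds one variable in t *)
| App (t u : tm)
| Cst (c : cst).

Definition upren (r : nat -> nat) (n : nat) : nat :=
  match n with 0 => 0 | S m => S (r m) end.

Fixpoint ren (r : nat -> nat) (t : tm) : tm :=
  match t with
  | Var n => Var (r n)
  | Univ i => Univ i
  | Pi A B => Pi (ren r A) (ren (upren r) B)
  | Lam t => Lam (ren (upren r) t)
  | App t u => App (ren r t) (ren r u)
  | Cst c => Cst c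
  end.

Definition lift (k : nat) : tm -> tm := ren (fun n => k + n).

Definition upsub (s : nat -> tm) (n : nat) : tm :=
  match n with 0 => Var 0 | S m => lift 1 (s m) end.

Fixpoint sub (s : nat -> tm) (t : tm) : tm :=
  match t with
  | Var n => s n
  | Univ i => Univ i
  | Pi A B => Pi (sub s A) (sub (upsub s) B)
  | Lam t => Lam (sub (upsub s) t)
  | App t u => App (sub s t) (sub s u)
  | Cst c => Cst c
  end.

Definition subst1 (u t : tm) : tm :=
  sub (fun n => match n with 0 => u | S m => Var m end) t.

Definition apps (t : tm) (us : list tm) : tm := fold_left App us t.

(* The computation rules do not repeat the parameters of the constructors: on
   well-typed terms they agree anyway, and the patterns remain linear. *)
Inductive iota : tm -> tm -> Prop :=
| iota_One P d :
    iota (apps (Cst indOne) [P; d; Cst star]) d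
| iota_zero P z s :
    iota (apps (Cst indNat) [P; z; s; Cst zero]) z
| iota_succ P z s n :
    iota (apps (Cst indNat) [P; z; s; App (Cst succ) n])
         (apps s [n; apps (Cst indNat) [P; z; s; n]])
| iota_inl A B P f g A' B' a :
    iota (apps (Cst indSum) [A; B; P; f; g; apps (Cst inl) [A'; B'; a]])
         (App f a)
| iota_inr A B P f g A' B' b :
    iota (apps (Cst indSum) [A; B; P; f; g; apps (Cst inr) [A'; B'; b]])
         (App g b)
| iota_pair A B P f A' B' a b :
    iota (apps (Cst indSigma) [A; B; P; f; apps (Cst pair) [A'; B'; a; b]])
         (apps f [a; b])
| iota_refl A a P d b A' a' :
    iota (apps (Cst J) [A; a; P; d; b; apps (Cst refl) [A'; a']]) d
| iota_inj X Y f g P d h X' Y' f' g' y :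
    iota (apps (Cst indCoeq)
            [X; Y; f; g; P; d; h; apps (Cst inj) [X'; Y'; f'; g'; y]])
         (App d y)
| iota_base A P b l A' :
    iota (apps (Cst indWedge) [A; P; b; l; App (Cst base) A']) b
| iota_tr k A P h d A' a :
    iota (apps (Cst (indTrunc k)) [A; P; h; d; apps (Cst (tr k)) [A'; a]])
         (App d a).

Inductive conv : tm -> tm -> Prop :=
| conv_beta t u : conv (App (Lam t) u) (subst1 u t)
| conv_eta t : conv (Lam (App (lift 1 t) (Var 0))) t
| conv_iota t u : iota t u -> conv t u
| conv_refl t : conv t t
| conv_sym t u : conv t u -> conv u t
| conv_trans t u v : conv t u -> conv u v -> conv t v
| conv_Pi A A' B B' : conv A A' -> conv B B' -> conv (Pi A B) (Pi A' B')
| conv_Lam t t' : conv t t' -> conv (Lam t) (Lam t')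
| conv_App t t' u u' : conv t t' -> conv u u' -> conv (App t u) (App t' u').

(* An [expr] is a term as a function of the number of binders above it. This
   lets object-level binders be written with Rocq binders: the variable bound
   at depth n is the de Bruijn index m - (n + 1) at depth m. *)
Definition expr : Type := nat -> tm.

Definition con (c : cst) : expr := fun _ => Cst c.
Coercion con : cst >-> expr.

Definition U (i : nat) : expr := fun _ => Univ i.
Definition ap (t u : expr) : expr := fun n => App (t n) (u n).
Definition bvar (n : nat) : expr := fun m => Var (m - S n).
Definition pi (A : expr) (B : expr -> expr) : expr :=
  fun n => Pi (A n) (B (bvar n) (S n)).
Definition lam (t : expr -> expr) : expr :=
  fun n => Lam (t (bvar n) (S n)).

Definition closed (t : expr) : tm := t 0.

Declare Scope hott_scope.
Delimit Scope hott_scope with hott.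
Bind Scope hott_scope with expr.
Local Open Scope hott_scope.

Notation "f · x" := (ap f x) (at level 36, left associativity) : hott_scope.
Notation "A ⇒ B" := (pi A (fun _ => B))
  (at level 56, right associativity) : hott_scope.
Notation "'Π' x : A , B" := (pi A (fun x => B))
  (at level 200, x name, A at level 150, B at level 200) : hott_scope.
Notation "'λ' x , t" := (lam (fun x => t))
  (at level 200, x name, t at level 200) : hott_scope.
Notation "'Σ' x : A , B" := (Sigma · A · (lam (fun x => B)))
  (at level 200, x name, A at level 150, B at level 200) : hott_scope.

Definition path (A x y : expr) : expr := Id · A · x · y.

(* transport A P x y p : P x -> P y *)
Definition transport (A P x y p : expr) : expr :=
  J · A · x · (λ z, λ q, P · x ⇒ P · z) · (λ u, u) · y · p.

(* pathover A P x y p u v : the type of paths from u to v over p *)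
Definition pathover (A P x y p u v : expr) : expr :=
  path (P · y) (transport A P x y p · u) v.

(* apd A P f x y p : pathover A P x y p (f x) (f y) *)
Definition apd (A P f x y p : expr) : expr :=
  J · A · x · (λ z, λ q, pathover A P x z q (f · x) (f · z))
    · (refl · (P · x) · (f · x)) · y · p.

(* happly A B f g : path (Π x : A, B x) f g -> Π x : A, path (B x) (f x) (g x) *)
Definition happly (A B f g : expr) : expr :=
  λ p, J · (Π x : A, B · x) · f
         · (λ h, λ q, Π x : A, path (B · x) (f · x) (h · x))
         · (λ x, refl · (B · x) · (f · x)) · g · p.

Definition rinv (A B f : expr) : expr :=
  Σ g : B ⇒ A, Π b : B, path B (f · (g · b)) b.

Definition linv (A B f : expr) : expr :=
  Σ h : B ⇒ A, Π a : A, path A (h · (f · a)) a.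

Definition isequiv (A B f : expr) : expr := Σ _r : rinv A B f, linv A B f.

Definition equiv (A B : expr) : expr := Σ f : A ⇒ B, isequiv A B f.

Definition idequiv (A : expr) : expr :=
  let id := λ x, x in
  pair · (A ⇒ A) · (λ f, isequiv A A f) · id
  · (pair · rinv A A id · (λ _r, linv A A id)
     · (pair · (A ⇒ A) · (λ g, Π b : A, path A (id · (g · b)) b)
          · id · (λ b, refl · A · b))
     · (pair · (A ⇒ A) · (λ h, Π a : A, path A (h · (id · a)) a)
          · id · (λ a, refl · A · a))).

(* idtoeqv i A B : path (U i) A B -> equiv A B *)
Definition idtoeqv (i : nat) (A B : expr) : expr :=
  λ p, J · U i · A · (λ X, λ q, equiv A X) · idequiv A · B · p.

(* hlevel k A : A is a (k - 2)-type *)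
Fixpoint hlevel (k : nat) (A : expr) : expr :=
  match k with
  | 0 => Σ a : A, Π x : A, path A a x
  | S k => Π x : A, Π y : A, hlevel k (path A x y)
  end.

Definition isset (A : expr) : expr := hlevel 2 A.

Definition settrunc (A : expr) : expr := Trunc 2 · A.

(* i is the universe of the parameters, j that of the motive of an eliminator;
   the levels are not part of the terms (typical ambiguity). *)
Definition cst_type (c : cst) (i j : nat) : expr :=
  match c with
  | Zero => U 0
  | indZero => Π P : Zero ⇒ U j, Π x : Zero, P · x

  | One => U 0
  | star => One
  | indOne => Π P : One ⇒ U j, P · star ⇒ Π x : One, P · x

  | Nat => U 0
  | zero => Nat
  | succ => Nat ⇒ Nat
  | indNat =>
      Π P : Nat ⇒ U j,
      P · zero ⇒ (Π n : Nat, P · n ⇒ P · (succ · n)) ⇒ Π n : Nat, P · n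

  | Sum => U i ⇒ U i ⇒ U i
  | inl => Π A : U i, Π B : U i, A ⇒ Sum · A · B
  | inr => Π A : U i, Π B : U i, B ⇒ Sum · A · B
  | indSum =>
      Π A : U i, Π B : U i, Π P : Sum · A · B ⇒ U j,
      (Π a : A, P · (inl · A · B · a)) ⇒
      (Π b : B, P · (inr · A · B · b)) ⇒
      Π s : Sum · A · B, P · s

  | Sigma => Π A : U i, (A ⇒ U i) ⇒ U i
  | pair => Π A : U i, Π B : A ⇒ U i, Π a : A, B · a ⇒ Sigma · A · B
  | indSigma =>
      Π A : U i, Π B : A ⇒ U i, Π P : Sigma · A · B ⇒ U j,
      (Π a : A, Π b : B · a, P · (pair · A · B · a · b)) ⇒
      Π s : Sigma · A · B, P · s

  | Id => Π A : U i, A ⇒ A ⇒ U i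
  | refl => Π A : U i, Π a : A, path A a a
  | J =>
      Π A : U i, Π a : A, Π P : (Π b : A, path A a b ⇒ U j),
      P · a · (refl · A · a) ⇒ Π b : A, Π p : path A a b, P · b · p

  | funext =>
      Π A : U i, Π B : A ⇒ U i,
      Π f : (Π x : A, B · x), Π g : (Π x : A, B · x),
      isequiv (path (Π x : A, B · x) f g)
              (Π x : A, path (B · x) (f · x) (g · x))
              (happly A B f g)
  | univalence =>
      Π A : U i, Π B : U i,
      isequiv (path (U i) A B) (equiv A B) (idtoeqv i A B)

  | Coeq => Π X : U i, Π Y : U i, (X ⇒ Y) ⇒ (X ⇒ Y) ⇒ U i
  | inj =>
      Π X : U i, Π Y : U i, Π f : X ⇒ Y, Π g : X ⇒ Y,
      Y ⇒ Coeq · X · Y · f · g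
  | glue =>
      Π X : U i, Π Y : U i, Π f : X ⇒ Y, Π g : X ⇒ Y,
      Π x : X, path (Coeq · X · Y · f · g) (inj · X · Y · f · g · (f · x))
                                           (inj · X · Y · f · g · (g · x))
  | indCoeq =>
      Π X : U i, Π Y : U i, Π f : X ⇒ Y, Π g : X ⇒ Y,
      Π P : Coeq · X · Y · f · g ⇒ U j,
      Π d : (Π y : Y, P · (inj · X · Y · f · g · y)),
      (Π x : X, pathover (Coeq · X · Y · f · g) P
                  (inj · X · Y · f · g · (f · x))
                  (inj · X · Y · f · g · (g · x))
                  (glue · X · Y · f · g · x) (d · (f · x)) (d · (g · x))) ⇒
      Π c : Coeq · X · Y · f · g, P · c
  | indCoeq_glue =>
      Π X : U i, Π Y : U i, Π f : X ⇒ Y, Π g : X ⇒ Y,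
      Π P : Coeq · X · Y · f · g ⇒ U j,
      Π d : (Π y : Y, P · (inj · X · Y · f · g · y)),
      Π h : (Π x : X, pathover (Coeq · X · Y · f · g) P
                        (inj · X · Y · f · g · (f · x))
                        (inj · X · Y · f · g · (g · x))
                        (glue · X · Y · f · g · x) (d · (f · x)) (d · (g · x))),
      Π x : X,
      path (pathover (Coeq · X · Y · f · g) P
              (inj · X · Y · f · g · (f · x))
              (inj · X · Y · f · g · (g · x))
              (glue · X · Y · f · g · x) (d · (f · x)) (d · (g · x)))
           (apd (Coeq · X · Y · f · g) P (indCoeq · X · Y · f · g · P · d · h)
              (inj · X · Y · f · g · (f · x))
              (inj · X · Y · f · g · (g · x))
              (glue · X · Y · f · g · x))
           (h · x)

  | Wedge => U i ⇒ U i
  | base => Π A : U i, Wedge · A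
  | loop => Π A : U i, A ⇒ path (Wedge · A) (base · A) (base · A)
  | indWedge =>
      Π A : U i, Π P : Wedge · A ⇒ U j, Π b : P · (base · A),
      (Π a : A, pathover (Wedge · A) P (base · A) (base · A)
                  (loop · A · a) b b) ⇒
      Π w : Wedge · A, P · w
  | indWedge_loop =>
      Π A : U i, Π P : Wedge · A ⇒ U j, Π b : P · (base · A),
      Π l : (Π a : A, pathover (Wedge · A) P (base · A) (base · A)
                        (loop · A · a) b b),
      Π a : A,
      path (pathover (Wedge · A) P (base · A) (base · A) (loop · A · a) b b)
           (apd (Wedge · A) P (indWedge · A · P · b · l)
              (base · A) (base · A) (loop · A · a))
           (l · a)

  | Trunc k => U i ⇒ U i
  | tr k => Π A : U i, A ⇒ Trunc k · A
  | istrunc k => Π A : U i, hlevel k (Trunc k · A)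
  | indTrunc k =>
      Π A : U i, Π P : Trunc k · A ⇒ U j,
      (Π t : Trunc k · A, hlevel k (P · t)) ⇒
      (Π a : A, P · (tr k · A · a)) ⇒
      Π t : Trunc k · A, P · t
  end.

Reserved Notation "G ⊢ t ∈ A" (at level 90, t at level 89, A at level 89).

Inductive wf : list tm -> Prop :=
| wf_nil : wf []
| wf_cons G A i : wf G -> G ⊢ A ∈ Univ i -> wf (A :: G)

with typing : list tm -> tm -> tm -> Prop :=
| ty_Var G n A :
    wf G -> nth_error G n = Some A -> G ⊢ Var n ∈ lift (S n) A
| ty_Univ G i :
    wf G -> G ⊢ Univ i ∈ Univ (S i)
| ty_cumul G A i :
    G ⊢ A ∈ Univ i -> G ⊢ A ∈ Univ (S i)
| ty_Pi G A B i :
    G ⊢ A ∈ Univ i -> A :: G ⊢ B ∈ Univ i -> G ⊢ Pi A B ∈ Univ i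
| ty_Lam G A B t :
    A :: G ⊢ t ∈ B -> G ⊢ Lam t ∈ Pi A B
| ty_App G A B t u :
    G ⊢ t ∈ Pi A B -> G ⊢ u ∈ A -> G ⊢ App t u ∈ subst1 u B
| ty_Cst G c i j :
    wf G -> G ⊢ Cst c ∈ closed (cst_type c i j)
| ty_conv G t A B i :
    G ⊢ t ∈ A -> conv A B -> G ⊢ B ∈ Univ i -> G ⊢ t ∈ B

where "G ⊢ t ∈ A" := (typing G t A).

Definition provable (T : expr) : Prop := exists t : tm, [] ⊢ t ∈ closed T.

(* [Wedge · A] is hcolim(A ⇉ 1). *)
Definition Omega (X x : expr) : expr := path X x x.

Definition freegroup (A : expr) : expr := Omega (Wedge · A) (base · A).

Definition fundgroup (X x : expr) : expr := settrunc (path X x x).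

(* Main.v *)
From Stdlib Require Import String List Arith Bool Lia.
Require Import Defs.
Import ListNotations.

(** Let [F] be the loop space of the wedge [W] of [A]-many circles.  Words in the
    letters [a], [a^-1] are evaluated in [F].  For [z : F], let [Inv z] be the type
    of predicates on pairs of a word [u] and a path [q : eval u = z] that are
    invariant under the deletion of adjacent inverse letters from [u] (with [q]
    adjusted accordingly).  Appending a letter gives [Inv z <~> Inv (z * loop a)],
    so by univalence [Inv] extends to a family over all [w : W] and [y : base = w].
    By path induction on [y], any element of [Inv 1] extends to a section of this
    family, and path induction on [q : 1 = z] then shows that this element holds at
    the empty word for _every_ path [1 = 1] as soon as it holds at [refl].

    It remains to find an element of [Inv 1] that says [|q = refl|] at the empty
    word: "[q] is merely obtained from [refl] by successive deletions".  Deletions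
    shorten words, and two deletions from the same word either have the same
    result or can be joined by one further deletion each, compatibly with the
    paths; this is where [A] has to be a set.  By induction on the length,
    invariance follows.  Decidability of equality in [A] is not needed because the
    predicate is proposition-valued.

    The resulting term is certified by a type checker that is proved sound for
    the typing relation. *)

(** * Renaming, substitution and universe shift *)

Scheme wf_mind := Minimality for wf Sort Prop
with typing_mind := Minimality for typing Sort Prop.
Combined Scheme wf_typing_ind from wf_mind, typing_mind.

Lemma upren_ext r r' : (forall n, r n = r' n) -> forall n, upren r n = upren r' n.
Proof. intros H [|n]; simpl; congruence. Qed.

Lemma ren_ext t : forall r r', (forall n, r n = r' n) -> ren r t = ren r' t.
Proof. induction t; simpl; intros; f_equal; auto using upren_ext. Qed.

Lemma upsub_ext s s' : (forall n, s n = s' n) -> forall n, upsub s n = upsub s' n.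
Proof. intros H [|n]; simpl; congruence. Qed.

Lemma sub_ext t : forall s s', (forall n, s n = s' n) -> sub s t = sub s' t.
Proof. induction t; simpl; intros; f_equal; auto using upsub_ext. Qed.

Lemma ren_ren t : forall r r', ren r (ren r' t) = ren (fun n => r (r' n)) t.
Proof.
  induction t; simpl; intros; f_equal; auto;
    rewrite IHt2 || rewrite IHt; apply ren_ext; intros [|m]; reflexivity.
Qed.

Lemma lift0 t : lift 0 t = t.
Proof.
  unfold lift. change (ren (fun n => n) t = t).
  assert (H : forall r, (forall n, r n = n) -> ren r t = t).
  { induction t; simpl; intros; f_equal; auto;
      (apply IHt2 || apply IHt); intros [|m]; simpl; auto. }
  apply H. reflexivity.
Qed.

Lemma ren_sub t : forall r s, ren r (sub s t) = sub (fun n => ren r (s n)) t.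
Proof.
  induction t; simpl; intros; f_equal; auto;
    rewrite IHt2 || rewrite IHt; apply sub_ext; intros [|m]; simpl; auto;
    unfold lift; rewrite !ren_ren; apply ren_ext; reflexivity.
Qed.

Lemma sub_ren t : forall r s, sub s (ren r t) = sub (fun n => s (r n)) t.
Proof.
  induction t; simpl; intros; f_equal; auto;
    rewrite IHt2 || rewrite IHt; apply sub_ext; intros [|m]; reflexivity.
Qed.

Lemma ren_subst1 r u t : ren r (subst1 u t) = subst1 (ren r u) (ren (upren r) t).
Proof.
  unfold subst1. rewrite ren_sub, sub_ren. apply sub_ext. intros [|m]; reflexivity.
Qed.

Lemma ren_lift1 r t : ren (upren r) (lift 1 t) = lift 1 (ren r t).
Proof. unfold lift. rewrite !ren_ren. apply ren_ext. reflexivity. Qed.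

Fixpoint scoped (n : nat) (t : tm) : Prop :=
  match t with
  | Var m => m < n
  | Univ _ | Cst _ => True
  | Pi A B => scoped n A /\ scoped (S n) B
  | Lam t => scoped (S n) t
  | App t u => scoped n t /\ scoped n u
  end.

Lemma scoped_ren t : forall n r, scoped n t -> (forall m, m < n -> r m = m) -> ren r t = t.
Proof.
  induction t; simpl; intros n' r H Hr; f_equal; intuition eauto;
    (eapply IHt2 || eapply IHt); eauto; intros [|m] Hm; simpl; auto; rewrite Hr; lia.
Qed.

Lemma scoped_sub t : forall n s, scoped n t -> (forall m, m < n -> s m = Var m) -> sub s t = t.
Proof.
  induction t; simpl; intros n' s H Hs; f_equal; intuition eauto;
    (eapply IHt2 || eapply IHt); eauto; intros [|m] Hm; simpl; auto; rewrite Hs by lia; reflexivity.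
Qed.

(** The level [k] is a variable in the types of [istrunc k] and [indTrunc k], so evaluation alone
    does not settle these. The hypothesis ranges over all depths [m >= n] because [A] is used again
    under the binders of [hlevel]. *)
Lemma scoped_hlevel k : forall A n,
  (forall m, n <= m -> scoped m (A m)) -> scoped n (hlevel k A n).
Proof.
  induction k as [|k IH]; intros A n HA.
  - cbn -[Nat.sub]. repeat split; solve [auto | apply HA; lia | lia].
  - cbn -[Nat.sub]. split; [|split]; try (apply HA; lia).
    apply IH. intros m Hm. cbn -[Nat.sub].
    repeat split; solve [auto | apply HA; lia | lia].
Qed.

Lemma scoped_cst c i j : scoped 0 (closed (cst_type c i j)).
Proof.
  destruct c; try solve [vm_compute; repeat split; lia];
    cbn -[Nat.sub hlevel]; repeat split; try lia;
    apply scoped_hlevel; intros m Hm; cbn -[Nat.sub]; repeat split; lia.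
Qed.

Lemma typing_scoped G t A : G ⊢ t ∈ A -> scoped (length G) t.
Proof.
  induction 1; simpl in *; auto.
  apply nth_error_Some. congruence.
Qed.

Lemma ren_iota r t u : iota t u -> iota (ren r t) (ren r u).
Proof. destruct 1; simpl; constructor. Qed.

Lemma ren_conv t u : conv t u -> forall r, conv (ren r t) (ren r u).
Proof.
  induction 1; intros r; simpl; try solve [econstructor; eauto].
  - rewrite ren_subst1. constructor.
  - rewrite ren_lift1. constructor.
  - apply conv_iota, ren_iota; auto.
Qed.

Definition ren_ok (r : nat -> nat) (G D : list tm) : Prop :=
  forall n A, nth_error G n = Some A ->
  exists A', nth_error D (r n) = Some A' /\ lift (S (r n)) A' = ren r (lift (S n) A).

Lemma ren_ok_cons r G D A : ren_ok r G D -> ren_ok (upren r) (A :: G) (ren r A :: D).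
Proof.
  intros H [|n] B HB; simpl in *.
  - injection HB as <-. exists (ren r A). split; auto.
    unfold lift. rewrite !ren_ren. apply ren_ext; reflexivity.
  - destruct (H n B HB) as [B' [H1 H2]]. exists B'. split; auto.
    unfold lift in *. rewrite ren_ren in *.
    transitivity (lift 1 (ren (fun m => S (r n) + m) B')).
    + unfold lift. rewrite ren_ren. apply ren_ext; reflexivity.
    + rewrite H2. unfold lift. rewrite ren_ren. apply ren_ext; reflexivity.
Qed.

(** [ty_Lam] does not ask its domain to be a type; this is only implicit in the well-formedness of
    the extended context. The induction therefore carries along that the context entries stay types
    under renaming, which is what allows it to go under the binder. [substitutable] does the same
    for substitutions. *)
Fixpoint renamable (G : list tm) : Prop :=
  match G with
  | [] => True
  | A :: G =>
      (forall D r, wf D -> ren_ok r G D -> exists i, D ⊢ ren r A ∈ Univ i) /\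
      renamable G
  end.

Lemma typing_ren_aux :
  (forall G, wf G -> renamable G) /\
  (forall G t A, G ⊢ t ∈ A ->
     renamable G /\ forall D r, wf D -> ren_ok r G D -> D ⊢ ren r t ∈ ren r A).
Proof.
  apply wf_typing_ind; simpl; auto.
  - intros G A i _ HG _ [_ IH]. split; auto. intros D r HD Hr. exists i. apply (IH D r); auto.
  - intros G n A _ IHG Hn. split; auto. intros D r HD Hr.
    destruct (Hr n A Hn) as [A' [H1 H2]]. rewrite <- H2. constructor; auto.
  - intros G i _ IHG. split; auto. intros; constructor; auto.
  - intros G A i _ [H IH]. split; auto. intros D r HD Hr; constructor; apply (IH D r); auto.
  - intros G A B i _ [H IHA] _ [H' IHB]. split; auto. intros D r HD Hr.
    assert (HA := IHA D r HD Hr). constructor; auto.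
    apply (IHB (ren r A :: D) (upren r)); [econstructor; eauto|apply ren_ok_cons; auto].
  - intros G A B t _ [[HA HG] IHt]. split; auto. intros D r HD Hr.
    destruct (HA D r HD Hr) as [i Hi]. constructor.
    apply IHt; [econstructor; eauto|apply ren_ok_cons; auto].
  - intros G A B t u _ [H IHt] _ [_ IHu]. split; auto. intros D r HD Hr.
    rewrite ren_subst1. econstructor; [apply (IHt D r)|apply (IHu D r)]; auto.
  - intros G c i j _ HG. split; auto. intros D r HD Hr.
    rewrite (scoped_ren _ 0) by (auto using scoped_cst; lia). constructor; auto.
  - intros G t A B i _ [H IHt] Hc _ [_ IHB]. split; auto. intros D r HD Hr.
    eapply ty_conv; [apply (IHt D r)|apply ren_conv, Hc|apply (IHB D r)]; auto.
Qed.

Lemma typing_weaken_closed G t A i :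
  [] ⊢ t ∈ A -> [] ⊢ A ∈ Univ i -> wf G -> G ⊢ t ∈ A.
Proof.
  intros Ht HA HG. apply typing_scoped in HA as SA. apply typing_scoped in Ht as St.
  apply typing_ren_aux in Ht as [_ H].
  specialize (H G (fun n => n) HG).
  rewrite !(scoped_ren _ 0) in H by (auto; lia).
  apply H. intros [|n] B HB; discriminate.
Qed.

(** * Stability of typing under substitution *)

Lemma sub_lift1 s t : sub (upsub s) (lift 1 t) = lift 1 (sub s t).
Proof. unfold lift. rewrite sub_ren, ren_sub. apply sub_ext. reflexivity. Qed.

Lemma sub_sub t : forall s s', sub s (sub s' t) = sub (fun n => sub s (s' n)) t.
Proof.
  induction t; simpl; intros; f_equal; auto;
    rewrite IHt2 || rewrite IHt; apply sub_ext; intros [|m]; auto; apply sub_lift1.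
Qed.

Lemma sub_Var t : forall s, (forall n, s n = Var n) -> sub s t = t.
Proof.
  induction t; simpl; intros; f_equal; auto;
    (apply IHt2 || apply IHt); intros [|m]; simpl; rewrite ?H; reflexivity.
Qed.

Lemma subst1_lift u t : subst1 u (lift 1 t) = t.
Proof. unfold subst1, lift. rewrite sub_ren. apply sub_Var. reflexivity. Qed.

Lemma sub_subst1 s u t : sub s (subst1 u t) = subst1 (sub s u) (sub (upsub s) t).
Proof.
  unfold subst1. rewrite !sub_sub. apply sub_ext. intros [|m]; simpl; auto.
  symmetry. apply subst1_lift.
Qed.

Lemma sub_conv t u : conv t u -> forall s, conv (sub s t) (sub s u).
Proof.
  induction 1; intros s; simpl; try solve [econstructor; eauto].
  - rewrite sub_subst1. constructor.
  - rewrite sub_lift1. constructor.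
  - apply conv_iota. destruct H; simpl; constructor.
Qed.

Lemma lift_lift1 n t : lift (S n) t = lift 1 (lift n t).
Proof. unfold lift. rewrite ren_ren. reflexivity. Qed.

Lemma typing_lift1 G t A B i :
  G ⊢ t ∈ A -> wf G -> G ⊢ B ∈ Univ i -> B :: G ⊢ lift 1 t ∈ lift 1 A.
Proof.
  intros Ht HG HB. apply (proj2 typing_ren_aux) in Ht as [_ H].
  apply H; [econstructor; eauto|].
  intros n C HC. exists C. split; auto. apply lift_lift1.
Qed.

Definition sub_ok (s : nat -> tm) (G D : list tm) : Prop :=
  forall n A, nth_error G n = Some A -> D ⊢ s n ∈ sub s (lift (S n) A).

Lemma sub_ok_cons s G D A i :
  wf D -> D ⊢ sub s A ∈ Univ i -> sub_ok s G D ->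
  sub_ok (upsub s) (A :: G) (sub s A :: D).
Proof.
  intros HD HA H [|n] B HB; simpl in *.
  - injection HB as <-. rewrite sub_lift1. apply ty_Var; auto. econstructor; eauto.
  - rewrite (lift_lift1 (S n)), sub_lift1. eapply typing_lift1; eauto.
Qed.

Fixpoint substitutable (G : list tm) : Prop :=
  match G with
  | [] => True
  | A :: G =>
      (forall D s, wf D -> sub_ok s G D -> exists i, D ⊢ sub s A ∈ Univ i) /\
      substitutable G
  end.

Lemma typing_sub_aux :
  (forall G, wf G -> substitutable G) /\
  (forall G t A, G ⊢ t ∈ A ->
     substitutable G /\ forall D s, wf D -> sub_ok s G D -> D ⊢ sub s t ∈ sub s A).
Proof.
  apply wf_typing_ind; simpl; auto.
  - intros G A i _ HG _ [_ IH]. split; auto. intros D r HD Hr. exists i. apply (IH D r); auto.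
  - intros G i _ IHG. split; auto. intros; constructor; auto.
  - intros G A i _ [H IH]. split; auto. intros D r HD Hr; constructor; apply (IH D r); auto.
  - intros G A B i _ [H IHA] _ [H' IHB]. split; auto. intros D r HD Hr.
    assert (HA := IHA D r HD Hr). constructor; auto.
    apply (IHB (sub r A :: D) (upsub r)); [econstructor; eauto|eapply sub_ok_cons; eauto].
  - intros G A B t _ [[HA HG] IHt]. split; auto. intros D r HD Hr.
    destruct (HA D r HD Hr) as [i Hi]. constructor.
    apply IHt; [econstructor; eauto|eapply sub_ok_cons; eauto].
  - intros G A B t u _ [H IHt] _ [_ IHu]. split; auto. intros D r HD Hr.
    rewrite sub_subst1. econstructor; [apply (IHt D r)|apply (IHu D r)]; auto.
  - intros G c i j _ HG. split; auto. intros D r HD Hr.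
    rewrite (scoped_sub _ 0) by (auto using scoped_cst; lia). constructor; auto.
  - intros G t A B i _ [H IHt] Hc _ [_ IHB]. split; auto. intros D r HD Hr.
    eapply ty_conv; [apply (IHt D r)|apply sub_conv, Hc|apply (IHB D r)]; auto.
Qed.

Lemma typing_subst1 G A B t u :
  wf G -> A :: G ⊢ t ∈ B -> G ⊢ u ∈ A -> G ⊢ subst1 u t ∈ subst1 u B.
Proof.
  intros HG Ht Hu. apply typing_sub_aux in Ht as [_ H]. apply H; auto.
  intros n C HC. rewrite lift_lift1. fold (subst1 u (lift 1 (lift n C))).
  rewrite subst1_lift. destruct n as [|n]; simpl in HC.
  - injection HC as <-. rewrite lift0. exact Hu.
  - apply ty_Var; auto.
Qed.

(** Between the use of [ty_Pi] and the end of the derivation there are only cumulativity and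
    conversion, which leave the subject unchanged. *)
Lemma Pi_inv G A B T : G ⊢ Pi A B ∈ T ->
  exists i, (G ⊢ A ∈ Univ i) /\ (A :: G ⊢ B ∈ Univ i).
Proof.
  intros H. remember (Pi A B) as t eqn:Q. induction H; try discriminate; auto.
  injection Q as -> ->. eauto.
Qed.

Lemma wf_nth G : wf G -> forall n A, nth_error G n = Some A ->
  exists i, G ⊢ lift (S n) A ∈ Univ i.
Proof.
  induction G as [|B G IH]; intros HG [|n] A HA; simpl in HA; try discriminate;
    inversion HG; subst.
  - injection HA as <-. exists i. eapply (typing_lift1 G _ (Univ i)); eauto.
  - destruct (IH H1 n A HA) as [j Hj]. exists j. rewrite lift_lift1.
    eapply (typing_lift1 G _ (Univ j)); eauto.
Qed.

(* Constants do not carry universe levels, so a derivation can be moved up by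
   [d] universes: it suffices to prove the theorem for [i = 0]. *)
Fixpoint lvl (d : nat) (t : tm) : tm :=
  match t with
  | Var n => Var n
  | Univ i => Univ (d + i)
  | Pi A B => Pi (lvl d A) (lvl d B)
  | Lam t => Lam (lvl d t)
  | App t u => App (lvl d t) (lvl d u)
  | Cst c => Cst c
  end.

Lemma lvl_ren d t : forall r, lvl d (ren r t) = ren r (lvl d t).
Proof. induction t; simpl; intros; f_equal; auto. Qed.

Lemma lvl_sub d t : forall s, lvl d (sub s t) = sub (fun n => lvl d (s n)) (lvl d t).
Proof.
  induction t; simpl; intros; f_equal; auto;
    rewrite IHt2 || rewrite IHt; apply sub_ext; intros [|m]; simpl; auto;
    apply lvl_ren.
Qed.

Lemma lvl_subst1 d u t : lvl d (subst1 u t) = subst1 (lvl d u) (lvl d t).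
Proof. unfold subst1. rewrite lvl_sub. apply sub_ext. intros [|m]; reflexivity. Qed.

Lemma lvl_conv d t u : conv t u -> conv (lvl d t) (lvl d u).
Proof.
  induction 1; simpl; try solve [econstructor; eauto].
  - rewrite lvl_subst1. constructor.
  - unfold lift. rewrite lvl_ren. apply conv_eta.
  - apply conv_iota. destruct H; simpl; constructor.
Qed.

Lemma lvl_hlevel d k : forall A A' n, (forall m, lvl d (A m) = A' m) ->
  lvl d (hlevel k A n) = hlevel k A' n.
Proof.
  induction k as [|k IH]; intros A A' n HA; simpl;
    cbv [pi lam path con ap bvar]; simpl; rewrite !HA; auto.
  do 2 f_equal. apply IH. intros m. simpl. rewrite HA. reflexivity.
Qed.

Lemma ty_cumul_add G A i d : G ⊢ A ∈ Univ i -> G ⊢ A ∈ Univ (d + i).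
Proof. intros H. induction d; simpl; auto using ty_cumul. Qed.

(** The constant is used at levels [d + i] and [d + j]. The types [U 0] of [Zero], [One] and [Nat]
    do not depend on these levels, and there cumulativity bridges the gap to [U d]. *)
Lemma lvl_cst G d c i j : wf G -> G ⊢ Cst c ∈ lvl d (closed (cst_type c i j)).
Proof.
  intros HG.
  assert (H := ty_Cst G c (d + i) (d + j) HG).
  destruct c; try exact H;
    try (unfold closed in *; simpl in *; replace (d + 0) with (d + 0) by lia;
         apply ty_cumul_add; exact H);
    unfold closed, cst_type, pi, ap, con, U, bvar in *; simpl in *;
    rewrite (lvl_hlevel d k _ _ _ (fun m => eq_refl)); exact H.
Qed.

Lemma typing_lvl d :
  (forall G, wf G -> wf (map (lvl d) G)) /\
  (forall G t A, G ⊢ t ∈ A -> map (lvl d) G ⊢ lvl d t ∈ lvl d A).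
Proof.
  apply wf_typing_ind; simpl; intros.
  - constructor.
  - econstructor; eauto.
  - unfold lift. rewrite lvl_ren. apply ty_Var; auto. rewrite nth_error_map, H1; auto.
  - rewrite Nat.add_succ_r. constructor; auto.
  - rewrite Nat.add_succ_r. constructor; auto.
  - constructor; auto.
  - constructor; auto.
  - rewrite lvl_subst1. econstructor; eauto.
  - apply lvl_cst; auto.
  - eapply ty_conv; eauto using lvl_conv.
Qed.

(** * A sound type checker *)

(* Terms with the data that typing needs but [tm] does not record: domains of
   abstractions, universe levels of constants, ascriptions, and names of closed
   definitions. *)
Inductive ctm : Type :=
| cVar (n : nat)
| cUniv (i : nat)
| cPi (A B : ctm)
| cLam (A : option ctm) (t : ctm)
| cApp (t u : ctm)
| cCst (c : cst) (i j : nat)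
| cAnn (t A : ctm)
| cDef (s : string).

Fixpoint cren (r : nat -> nat) (t : ctm) : ctm :=
  match t with
  | cVar n => cVar (r n)
  | cUniv i => cUniv i
  | cPi A B => cPi (cren r A) (cren (upren r) B)
  | cLam A t => cLam (option_map (cren r) A) (cren (upren r) t)
  | cApp t u => cApp (cren r t) (cren r u)
  | cCst c i j => cCst c i j
  | cAnn t A => cAnn (cren r t) (cren r A)
  | cDef s => cDef s
  end.

Definition clift (k : nat) : ctm -> ctm := cren (fun n => k + n).

Definition cupsub (s : nat -> ctm) (n : nat) : ctm :=
  match n with 0 => cVar 0 | S m => clift 1 (s m) end.

Fixpoint csub (s : nat -> ctm) (t : ctm) : ctm :=
  match t with
  | cVar n => s n
  | cUniv i => cUniv i
  | cPi A B => cPi (csub s A) (csub (cupsub s) B)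
  | cLam A t => cLam (option_map (csub s) A) (csub (cupsub s) t)
  | cApp t u => cApp (csub s t) (csub s u)
  | cCst c i j => cCst c i j
  | cAnn t A => cAnn (csub s t) (csub s A)
  | cDef s => cDef s
  end.

Definition csubst1 (u t : ctm) : ctm :=
  csub (fun n => match n with 0 => u | S m => cVar m end) t.

(* Constants in the types of constants are used at level 3, which is enough for
   everything below; by cumulativity they apply to smaller types as well. *)
Fixpoint emb (t : tm) : ctm :=
  match t with
  | Var n => cVar n
  | Univ i => cUniv i
  | Pi A B => cPi (emb A) (emb B)
  | Lam t => cLam None (emb t)
  | App t u => cApp (emb t) (emb u)
  | Cst c => cCst c 3 3
  end.

Definition cst_eq_dec (c c' : cst) : {c = c'} + {c <> c'}.
Proof. decide equality; apply Nat.eq_dec. Defined.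

Definition cst_eqb (c c' : cst) : bool := if cst_eq_dec c c' then true else false.

(* Equality up to annotations. *)
Fixpoint aeqb (t u : ctm) {struct t} : bool :=
  match t with
  | cAnn t _ => aeqb t u
  | _ =>
    (fix aux (u : ctm) : bool :=
       match u with
       | cAnn u _ => aux u
       | _ =>
         match t, u with
         | cVar n, cVar m => Nat.eqb n m
         | cUniv i, cUniv j => Nat.eqb i j
         | cPi A B, cPi A' B' => if aeqb A A' then aeqb B B' else false
         | cLam _ t, cLam _ u => aeqb t u
         | cApp t u, cApp t' u' => if aeqb t t' then aeqb u u' else false
         | cCst c _ _, cCst c' _ _ => cst_eqb c c'
         | cDef s, cDef s' => String.eqb s s'
         | _, _ => false
         end
       end) u
  end.

Fixpoint spine (t : ctm) (l : list ctm) : option (cst * list ctm) :=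
  match t with
  | cCst c _ _ => Some (c, l)
  | cApp t u => spine t (u :: l)
  | cAnn t _ => spine t l
  | _ => None
  end.

(* The number of arguments of an eliminator before its scrutinee; 0 stands for
   "not an eliminator". *)
Definition arity (c : cst) : nat :=
  match c with
  | indOne => 2 | indNat => 3 | indSum => 5 | indSigma => 4
  | J => 5 | indWedge => 4 | indTrunc _ => 4 | _ => 0
  end.

Definition contract (c : cst) (l : list ctm) (c' : cst) (l' : list ctm) : option ctm :=
  match c, l, c', l' with
  | indOne, [_; d], star, [] => Some d
  | indNat, [_; z; _], zero, [] => Some z
  | indNat, [P; z; s], succ, [n] =>
      Some (cApp (cApp s n)
              (cApp (cApp (cApp (cApp (cCst indNat 0 0) P) z) s) n))
  | indSum, [_; _; _; f; _], inl, [_; _; a] => Some (cApp f a)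
  | indSum, [_; _; _; _; g], inr, [_; _; b] => Some (cApp g b)
  | indSigma, [_; _; _; f], pair, [_; _; a; b] => Some (cApp (cApp f a) b)
  | J, [_; _; _; d; _], refl, [_; _] => Some d
  | indWedge, [_; _; b; _], base, [_] => Some b
  | indTrunc k, [_; _; _; d], tr k', [_; a] =>
      if Nat.eqb k k' then Some (cApp d a) else None
  | _, _, _, _ => None
  end.

(* The type formers whose universe level is read off their arguments. *)
Inductive former : Type :=
| vId (A x y : ctm)
| vSigma (A B : ctm)
| vSum (A B : ctm)
| vUnary (A : ctm)
| vRedex (b : ctm)
| vOther.

(** The types of constants contain redexes, for instance where [isequiv] is applied to [happly], and
    their abstractions have no recorded domain. [vRedex] lets the domain be inferred from the
    argument. *)
Definition view (t u : ctm) : former :=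
  match t with
  | cLam None b => vRedex b
  | cCst (Trunc _) _ _ | cCst Wedge _ _ => vUnary u
  | cApp (cCst Sum _ _) A => vSum A u
  | cApp (cCst Sigma _ _) A => match u with cLam _ B => vSigma A B | _ => vOther end
  | cApp (cApp (cCst Id _ _) A) x => vId A x u
  | _ => vOther
  end.

Definition table : Type := list (string * (ctm * ctm)).

Definition eq_level (x y : cst * nat * nat) : bool :=
  let '(c, i, j) := x in let '(c', i', j') := y in
  cst_eqb c c' && Nat.eqb i i' && Nat.eqb j j'.

Fixpoint lookup (T : table) (s : string) : option (ctm * ctm) :=
  match T with
  | [] => None
  | (s', e) :: T => if String.eqb s s' then Some e else lookup T s
  end.

Section Checker.
Variables (consts : list (cst * nat * nat)) (tab : table).

Fixpoint whnf (f : nat) (t : ctm) : ctm :=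
  match f with
  | 0 => t
  | S f =>
    match t with
    | cAnn t _ => whnf f t
    | cDef s => match lookup tab s with Some (b, _) => whnf f b | None => t end
    | cApp t u =>
      match whnf f t with
      | cLam _ b => whnf f (csubst1 u b)
      | t' =>
        match spine t' [] with
        | Some (c, l) =>
          if Nat.eqb (arity c) (List.length l) then
            match spine (whnf f u) [] with
            | Some (c', l') =>
              match contract c l c' l' with
              | Some v => whnf f v
              | None => cApp t' u
              end
            | None => cApp t' u
            end
          else cApp t' u
        | None => cApp t' u
        end
      end
    | _ => t
    end
  end.

Fixpoint unapp (t : ctm) (l : list ctm) : ctm * list ctm :=
  match t with
  | cApp t u => unapp t (u :: l)
  | cAnn t _ => unapp t l
  | _ => (t, l)
  end.

(* Conditionals rather than [&&] and [||]: call-by-value evaluation must not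
   compare what is already decided. *)
Fixpoint all_conv (cmp : ctm -> ctm -> bool) (l l' : list ctm) : bool :=
  match l, l' with
  | t :: l, t' :: l' => if cmp t t' then all_conv cmp l l' else false
  (* A harmless default: [conv_spines] compares the lengths first. *)
  | _, _ => true
  end.

Definition conv_spines (cmp : ctm -> ctm -> bool) (t u : ctm) : bool :=
  let (h, l) := unapp t [] in
  let (h', l') := unapp u [] in
  if aeqb h h' then
    if Nat.eqb (List.length l) (List.length l') then all_conv cmp l l' else false
  else false.

(** Spines are compared argumentwise before anything is unfolded, so that names stay folded where
    possible; failure there decides nothing. An abstraction is compared with a term of another form
    by eta. *)
Fixpoint cconv (f : nat) (t u : ctm) : bool :=
  match f with
  | 0 => false
  | S f =>
    if aeqb t u then true else
    if conv_spines (cconv f) t u then true else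
    match whnf f t, whnf f u with
    | cPi A B, cPi A' B' => if cconv f A A' then cconv f B B' else false
    | cLam _ t, cLam _ u => cconv f t u
    | cLam _ t, u => cconv f t (cApp (clift 1 u) (cVar 0))
    | t, cLam _ u => cconv f (cApp (clift 1 t) (cVar 0)) u
    | t, u => conv_spines (cconv f) t u
    end
  end.

Definition bind (r : option ctm) (k : ctm -> option ctm) : option ctm :=
  match r with Some A => k A | None => None end.

Local Notation "A <- r ; k" := (bind r (fun A => k))
  (at level 60, r at level 59, right associativity).

Definition as_univ (f : nat) (A : ctm) (k : nat -> option ctm) : option ctm :=
  match whnf f A with cUniv i => k i | _ => None end.

(* Types are inferred once and then known to be types, except after [whnf]:
   subject reduction is not available, so weak head normal forms are checked
   again. *)
Fixpoint infer (f : nat) (G : list ctm) (t : ctm) {struct f} : option ctm :=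
  match f with
  | 0 => None
  | S f =>
    match t with
    | cVar n => option_map (clift (S n)) (nth_error G n)
    | cUniv i => Some (cUniv (S i))
    | cPi A B =>
        S1 <- infer f G A; as_univ f S1 (fun i =>
        S2 <- infer f (A :: G) B; as_univ f S2 (fun j =>
        Some (cUniv (max i j))))
    | cLam (Some A) t =>
        S1 <- infer f G A; as_univ f S1 (fun i =>
        B <- infer f (A :: G) t; Some (cPi A B))
    | cLam None _ => None
    | cAnn t A =>
        S1 <- infer f G A; as_univ f S1 (fun i =>
        if check f G t A then Some A else None)
    | cDef s => match lookup tab s with Some (_, A) => Some A | None => None end
    | cCst c i j =>
        if existsb (eq_level (c, i, j)) consts
        then Some (emb (closed (cst_type c i j))) else None
    | cApp t u =>
      match view t u with
      | vId A x y =>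
          S1 <- infer f G A; as_univ f S1 (fun i =>
          if check f G x A then if check f G y A then Some (cUniv i) else None else None)
      | vSigma A B =>
          S1 <- infer f G A; as_univ f S1 (fun i =>
          S2 <- infer f (A :: G) B; as_univ f S2 (fun j =>
          Some (cUniv (max i j))))
      | vSum A B =>
          S1 <- infer f G A; as_univ f S1 (fun i =>
          S2 <- infer f G B; as_univ f S2 (fun j =>
          Some (cUniv (max i j))))
      | vUnary A => S1 <- infer f G A; as_univ f S1 (fun i => Some (cUniv i))
      | vRedex b => A <- infer f G u; B <- infer f (A :: G) b; Some (csubst1 u B)
      | vOther =>
          T <- infer f G t;
          match T with
          | cPi A B => if check f G u A then Some (csubst1 u B) else None
          | _ =>
            match whnf f T with
            | cPi A B =>
                S1 <- infer f G (cPi A B); as_univ f S1 (fun i =>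
                if check f G u A then Some (csubst1 u B) else None)
            | _ => None
            end
          end
      end
    end
  end

with check (f : nat) (G : list ctm) (t A : ctm) {struct f} : bool :=
  match f with
  | 0 => false
  | S f =>
    match t with
    | cLam _ b =>
      match A with
      | cPi X Y => check f (X :: G) b Y
      | _ =>
        match whnf f A with
        | cPi X Y =>
          match S1 <- infer f G (cPi X Y); as_univ f S1 (fun i => Some S1) with
          | Some _ => check f (X :: G) b Y
          | None => false
          end
        | _ => false
        end
      end
    | _ =>
      match infer f G t with
      | Some A' =>
        if cconv f A' A then true else
        match whnf f A', whnf f A with
        | cUniv i, cUniv j => Nat.leb i j
        | _, _ => false
        end
      | None => false
      end
    end
  end.
End Checker.

(** * Erasure and soundness of the checker *)

Fixpoint erase (E : string -> tm) (t : ctm) : tm :=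
  match t with
  | cVar n => Var n
  | cUniv i => Univ i
  | cPi A B => Pi (erase E A) (erase E B)
  | cLam _ t => Lam (erase E t)
  | cApp t u => App (erase E t) (erase E u)
  | cCst c _ _ => Cst c
  | cAnn t _ => erase E t
  | cDef s => E s
  end.

Fixpoint meaning (T : table) (s : string) : tm :=
  match T with
  (* An arbitrary closed term, so that every name has a closed meaning. *)
  | [] => Univ 0
  | (s', (b, _)) :: T => if String.eqb s s' then erase (meaning T) b else meaning T s
  end.

Lemma erase_emb E t : erase E (emb t) = t.
Proof. induction t; simpl; congruence. Qed.

Lemma aeqb_sound E t : forall u, aeqb t u = true -> erase E t = erase E u.
Proof.
  induction t; induction u; cbn -[Nat.eqb]; intros H; try discriminate; auto;
    try exact (IHt1 _ H);
    try (destruct (aeqb t1 u1) eqn:Q; [|discriminate]);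
    try (apply Nat.eqb_eq in H; congruence);
    try (f_equal; auto; fail).
  - unfold cst_eqb in H. destruct cst_eq_dec; congruence.
  - apply String.eqb_eq in H. congruence.
Qed.

Lemma spine_sound E t : forall l c l', spine t l = Some (c, l') ->
  apps (erase E t) (map (erase E) l) = apps (Cst c) (map (erase E) l').
Proof.
  induction t; simpl; intros l c' l' H; try discriminate; auto.
  - apply IHt1 in H. exact H.
  - congruence.
Qed.

Lemma contract_sound E c l c' l' v :
  contract c l c' l' = Some v ->
  conv (App (apps (Cst c) (map (erase E) l)) (apps (Cst c') (map (erase E) l')))
       (erase E v).
Proof.
  intros H. unfold contract in H.
  destruct c; try discriminate;
    repeat (destruct l as [|? l]; try discriminate);
    destruct c'; try discriminate;
    repeat (destruct l' as [|? l']; try discriminate);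
    try (destruct (Nat.eqb_spec k k0); [subst|discriminate]);
    injection H as <-; apply conv_iota;
    first [ apply iota_One | apply iota_zero | apply iota_succ | apply iota_inl
          | apply iota_inr | apply iota_pair | apply iota_refl | apply iota_base
          | apply iota_tr ].
Qed.

Lemma ty_Id G A x y i :
  wf G -> G ⊢ A ∈ Univ i -> G ⊢ x ∈ A -> G ⊢ y ∈ A ->
  G ⊢ App (App (App (Cst Id) A) x) y ∈ Univ i.
Proof.
  intros HG HA Hx Hy.
  assert (K := ty_Cst _ Id i 0 HG).
  apply (ty_App _ _ _ _ A) in K; auto.
  change (G ⊢ App (Cst Id) A ∈ Pi A (Pi (lift 1 A) (Univ i))) in K.
  apply (ty_App _ _ _ _ x) in K; auto.
  change (G ⊢ App (App (Cst Id) A) x ∈ Pi (subst1 x (lift 1 A)) (Univ i)) in K.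
  rewrite subst1_lift in K.
  apply (ty_App _ _ _ _ y) in K; auto.
Qed.

Lemma ty_Sum G A B i :
  wf G -> G ⊢ A ∈ Univ i -> G ⊢ B ∈ Univ i -> G ⊢ App (App (Cst Sum) A) B ∈ Univ i.
Proof.
  intros HG HA HB.
  assert (K := ty_Cst _ Sum i 0 HG).
  apply (ty_App _ _ _ _ A) in K; auto. apply (ty_App _ _ _ _ B) in K; auto.
Qed.

Lemma ty_Sigma G A B i :
  wf G -> G ⊢ A ∈ Univ i -> A :: G ⊢ B ∈ Univ i ->
  G ⊢ App (App (Cst Sigma) A) (Lam B) ∈ Univ i.
Proof.
  intros HG HA HB.
  assert (K := ty_Cst _ Sigma i 0 HG).
  apply (ty_App _ _ _ _ A) in K; auto.
  apply (ty_App _ _ _ _ (Lam B)) in K; auto.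
  apply ty_Lam. exact HB.
Qed.

Lemma view_sound E t u :
  match view t u with
  | vId A x y =>
      erase E (cApp t u) = App (App (App (Cst Id) (erase E A)) (erase E x)) (erase E y)
  | vSigma A B => erase E (cApp t u) = App (App (Cst Sigma) (erase E A)) (Lam (erase E B))
  | vSum A B => erase E (cApp t u) = App (App (Cst Sum) (erase E A)) (erase E B)
  | vUnary A => exists c, (forall i j, closed (cst_type c i j) = Pi (Univ i) (Univ i)) /\
      erase E (cApp t u) = App (Cst c) (erase E A)
  | vRedex b => erase E (cApp t u) = App (Lam (erase E b)) (erase E u)
  | vOther => True
  end.
Proof.
  destruct t as [ | | |[A|] b|t1 t2|c i j| | ]; simpl; auto.
  - destruct t1 as [ | | | |t3 t4|c i j| | ]; simpl; auto.
    + destruct t3 as [ | | | | |c i j| | ]; simpl; auto. destruct c; simpl; auto.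
    + destruct c; simpl; auto. destruct u; simpl; auto.
  - destruct c; simpl; auto; eexists; (split; [|reflexivity]); reflexivity.
Qed.

Section Soundness.
Variables (consts : list (cst * nat * nat)) (tab : table) (E : string -> tm).
Hypothesis consts_ok : forall c i j, In (c, i, j) consts ->
  exists k, [] ⊢ closed (cst_type c i j) ∈ Univ k.
Hypothesis E_closed : forall s, scoped 0 (E s).
Hypothesis E_tab : forall s b A, lookup tab s = Some (b, A) ->
  E s = erase E b /\ ([] ⊢ E s ∈ erase E A) /\ exists i, [] ⊢ erase E A ∈ Univ i.

Notation e := (erase E).

Lemma erase_ren t : forall r, e (cren r t) = ren r (e t).
Proof.
  induction t as [n|i|t1 IHt1 t2 IHt2|o t IHt|t1 IHt1 t2 IHt2|c i j|t IHt t2 IHt2|s0];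
    simpl; intros; f_equal; auto.
  symmetry. apply scoped_ren with 0; auto. lia.
Qed.

Lemma erase_sub t : forall s, e (csub s t) = sub (fun n => e (s n)) (e t).
Proof.
  induction t as [n|i|t1 IHt1 t2 IHt2|o t IHt|t1 IHt1 t2 IHt2|c i j|t IHt t2 IHt2|s0];
    simpl; intros; f_equal; auto.
  - rewrite IHt2. apply sub_ext. intros [|m]; simpl; auto. apply erase_ren.
  - rewrite IHt. apply sub_ext. intros [|m]; simpl; auto. apply erase_ren.
  - symmetry. apply scoped_sub with 0; auto. lia.
Qed.

Lemma erase_subst1 u t : e (csubst1 u t) = subst1 (e u) (e t).
Proof. unfold csubst1, subst1. rewrite erase_sub. apply sub_ext. intros [|m]; reflexivity. Qed.

Lemma whnf_sound f : forall t, conv (e t) (e (whnf tab f t)).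
Proof.
  induction f as [|f IH]; intros t; simpl; [apply conv_refl|].
  destruct t as [n|i|X Y|o b|t1 t2|c i j|t X|s]; try apply conv_refl.
  - assert (D : conv (e (cApp t1 t2)) (e (cApp (whnf tab f t1) t2))).
    { simpl. apply conv_App; [apply IH|apply conv_refl]. }
    (* The branch of [whnf] for heads other than abstractions, isolated so that it serves all of
       them. *)
    assert (N : forall t', conv (e (cApp t' t2)) (e
      match spine t' [] with
      | Some (c, l) =>
        if Nat.eqb (arity c) (List.length l) then
          match spine (whnf tab f t2) [] with
          | Some (c', l') =>
            match contract c l c' l' with
            | Some v => whnf tab f v
            | None => cApp t' t2
            end
          | None => cApp t' t2
          end
        else cApp t' t2
      | None => cApp t' t2
      end)).
    { intros t'.
      destruct (spine t' []) as [[c l]|] eqn:HS; [|apply conv_refl].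
      destruct Nat.eqb; [|apply conv_refl].
      destruct (spine (whnf tab f t2) []) as [[c' l']|] eqn:HS'; [|apply conv_refl].
      destruct contract eqn:HC; [|apply conv_refl].
      eapply conv_trans; [|apply IH].
      apply (contract_sound E) in HC. apply (spine_sound E) in HS, HS'.
      eapply conv_trans; [|apply HC].
      rewrite <- HS, <- HS'. apply conv_App; [apply conv_refl|apply IH]. }
    destruct (whnf tab f t1) as [| | |A b| | | |];
      try (match type of D with conv _ (e (cApp ?t' _)) =>
             solve [eapply conv_trans; [exact D|exact (N t')]] end).
    eapply conv_trans; [exact D|]. simpl.
    eapply conv_trans; [apply conv_beta|]. rewrite <- erase_subst1. apply IH.
  - simpl. apply IH.
  - destruct (lookup tab s) as [[b A]|] eqn:L; [|apply conv_refl].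
    apply E_tab in L as [H _]. simpl. rewrite H. apply IH.
Qed.

Lemma unapp_sound t : forall l h l', unapp t l = (h, l') ->
  apps (e t) (map e l) = apps (e h) (map e l').
Proof.
  induction t; simpl; intros l h l' H; try (injection H as <- <-; reflexivity); auto.
  apply IHt1 in H. exact H.
Qed.

Lemma conv_apps cmp :
  (forall t u, cmp t u = true -> conv (e t) (e u)) ->
  forall l l' t t', conv t t' -> List.length l = List.length l' ->
  all_conv cmp l l' = true -> conv (apps t (map e l)) (apps t' (map e l')).
Proof.
  intros IH l.
  induction l as [|u l IHl]; intros [|u' l'] t t' Ht Hl H; try discriminate; simpl; auto.
  simpl in H. destruct (cmp u u') eqn:C; [|discriminate].
  apply IHl; auto. apply conv_App; auto.
Qed.

Lemma conv_eta_l t u : conv t (App (lift 1 u) (Var 0)) -> conv (Lam t) u.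
Proof. intros H. eapply conv_trans; [apply conv_Lam, H|apply conv_eta]. Qed.

Lemma conv_spines_sound cmp :
  (forall t u, cmp t u = true -> conv (e t) (e u)) ->
  forall t u, conv_spines cmp t u = true -> conv (e t) (e u).
Proof.
  intros IH t u H. unfold conv_spines in H.
  destruct (unapp t []) as [h l] eqn:Ht. destruct (unapp u []) as [h' l'] eqn:Hu.
  destruct (aeqb h h') eqn:H1; [|discriminate].
  destruct (Nat.eqb_spec (List.length l) (List.length l')); [|discriminate].
  apply unapp_sound in Ht, Hu. simpl in Ht, Hu. rewrite Ht, Hu.
  apply (conv_apps cmp); auto.
  rewrite (aeqb_sound E _ _ H1). apply conv_refl.
Qed.

Lemma cconv_sound f : forall t u, cconv tab f t u = true -> conv (e t) (e u).
Proof.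
  induction f as [|f IH]; intros t u H; [discriminate|].
  cbn -[conv_spines aeqb] in H.
  destruct (aeqb t u) eqn:Q; [rewrite (aeqb_sound E t u Q); apply conv_refl|].
  destruct (conv_spines (cconv tab f) t u) eqn:Q'; [eapply conv_spines_sound; eauto|].
  { eapply conv_trans; [apply (whnf_sound f)|].
    eapply conv_trans; [|apply conv_sym, (whnf_sound f)].
    assert (EL : forall A t u, cconv tab f t (cApp (clift 1 u) (cVar 0)) = true ->
                   conv (e (cLam A t)) (e u)).
    { intros A t' u' H'. apply IH in H'. simpl in *. apply conv_eta_l.
      unfold clift in H'. rewrite erase_ren in H'. exact H'. }
    assert (ER : forall A t u, cconv tab f (cApp (clift 1 u) (cVar 0)) t = true ->
                   conv (e u) (e (cLam A t))).
    { intros A t' u' H'. apply IH in H'. simpl in *. apply conv_sym, conv_eta_l.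
      unfold clift in H'. rewrite erase_ren in H'. apply conv_sym, H'. }
    destruct (whnf tab f t); destruct (whnf tab f u);
      try (apply EL; exact H); try (apply ER; exact H);
      try (eapply conv_spines_sound; eauto; fail);
      simpl; [|auto using conv_Lam].
    match type of H with (if ?c then _ else _) = _ => destruct c eqn:C; [|discriminate] end.
    auto using conv_Pi. }
Qed.

Lemma ty_cumul_le G A i j : G ⊢ A ∈ Univ i -> i <= j -> G ⊢ A ∈ Univ j.
Proof. induction 2; auto using ty_cumul. Qed.

Lemma bind_Some r k B : bind r k = Some B -> exists A, r = Some A /\ k A = Some B.
Proof. destruct r; simpl; [eauto|discriminate]. Qed.

Lemma if_Some (b : bool) (x : option ctm) B :
  (if b then x else None) = Some B -> b = true /\ x = Some B.
Proof. destruct b; [auto|discriminate]. Qed.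

Definition is_type (G : list ctm) (A : ctm) : Prop := exists i, map e G ⊢ e A ∈ Univ i.

(** Inference delivers a type together with the fact that it is one, while checking presupposes this
    fact. It supplies the last premise of [ty_conv] without checking types again. *)
Definition infer_ok f := forall G t A, infer consts tab f G t = Some A ->
  wf (map e G) -> (map e G ⊢ e t ∈ e A) /\ is_type G A.
Definition check_ok f := forall G t A, check consts tab f G t A = true ->
  wf (map e G) -> is_type G A -> map e G ⊢ e t ∈ e A.

Lemma infer_univ f : infer_ok f -> forall g G t k B,
  bind (infer consts tab f G t) (fun A => as_univ tab g A (k A)) = Some B ->
  wf (map e G) -> exists i A, (map e G ⊢ e t ∈ Univ i) /\ k A i = Some B.
Proof.
  intros IH g G t k B H HG. apply bind_Some in H as [A [H1 H]].
  apply IH in H1 as [H1 _]; auto. unfold as_univ in H.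
  assert (HA := whnf_sound g A).
  destruct (whnf tab g A) as [|i| | | | | |]; try discriminate.
  exists i, A. split; auto. eapply ty_conv; eauto. apply ty_Univ; auto.
Qed.

Lemma is_univ G i : wf (map e G) -> is_type G (cUniv i).
Proof. exists (S i). apply ty_Univ; auto. Qed.

Lemma is_Pi G A B : is_type G (cPi A B) -> wf (map e G) ->
  is_type G A /\ is_type (A :: G) B /\ wf (map e (A :: G)).
Proof.
  intros [i H] HG. apply Pi_inv in H as [j [HA HB]].
  repeat split; try (exists j; auto). simpl. econstructor; eauto.
Qed.

Lemma check_step f : infer_ok f -> check_ok f -> check_ok (S f).
Proof.
  intros IH IC G t A H HG HA. red in IC.
  (* The change of mode: inferred and given type are convertible, or both reduce to universes and
     cumulativity applies. *)
  assert (main : forall t, match infer consts tab f G t with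
      | Some A' =>
        if cconv tab f A' A then true else
        match whnf tab f A', whnf tab f A with
        | cUniv i, cUniv j => Nat.leb i j
        | _, _ => false
        end
      | None => false
      end = true -> map e G ⊢ e t ∈ e A).
  { clear H t. intros t H. destruct (infer consts tab f G t) as [A'|] eqn:H1; [|discriminate].
    apply IH in H1 as [H1 _]; auto. destruct HA as [k HA].
    destruct (cconv tab f A' A) eqn:C.
    { eapply ty_conv; eauto. eapply cconv_sound; eauto. }
    assert (W0 := whnf_sound f A'). assert (W := whnf_sound f A).
    destruct (whnf tab f A') as [|i| | | | | |]; try discriminate.
    destruct (whnf tab f A) as [|j| | | | | |]; try discriminate.
    apply Nat.leb_le in H.
    eapply ty_conv; [|apply conv_sym; exact W|eauto].
    simpl. apply ty_cumul_le with i; auto. eapply ty_conv; eauto. apply ty_Univ; auto. }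
  destruct t as [| | | o b | | | |]; try (apply main; exact H). clear main.
  cbn in H.
  assert (lam : forall X Y, is_type G (cPi X Y) -> check consts tab f (X :: G) b Y = true ->
    map e G ⊢ e (cLam o b) ∈ Pi (e X) (e Y)).
  { intros X Y HP H'. apply is_Pi in HP as [_ [HY HX]]; auto.
    apply IC in H'; auto. apply ty_Lam. exact H'. }
  assert (whn : match whnf tab f A with
        | cPi X Y =>
          match bind (infer consts tab f G (cPi X Y))
                  (fun S1 => as_univ tab f S1 (fun i => Some S1)) with
          | Some _ => check consts tab f (X :: G) b Y
          | None => false
          end
        | _ => false
        end = true -> map e G ⊢ e (cLam o b) ∈ e A).
  { clear H. intros H. assert (W := whnf_sound f A).
    destruct (whnf tab f A) as [| |X Y| | | | |]; try discriminate.
    destruct bind eqn:B in H; [|discriminate].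
    apply (infer_univ f IH f G (cPi X Y) (fun A _ => Some A)) in B as [i [_ [Hi _]]]; auto.
    apply lam in H; [|exists i; auto].
    destruct HA as [k HA]. eapply ty_conv; [exact H|apply conv_sym, W|exact HA]. }
  destruct A as [| |X Y| | | | |]; try (apply whn; exact H).
  apply lam; auto.
Qed.

Lemma is_type_subst1 G A B u :
  wf (map e G) -> is_type (A :: G) B -> map e G ⊢ e u ∈ e A -> is_type G (csubst1 u B).
Proof.
  intros HG [i HB] Hu. exists i. rewrite erase_subst1.
  apply (typing_subst1 _ (e A) (Univ i)); auto.
Qed.

Lemma infer_step f : infer_ok f -> check_ok f -> infer_ok (S f).
Proof.
  intros IH IC G t A H HG. red in IC.
  assert (univ : forall G t k B,
    bind (infer consts tab f G t) (fun A => as_univ tab f A k) = Some B ->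
    wf (map e G) -> exists i, (map e G ⊢ e t ∈ Univ i) /\ k i = Some B).
  { intros G' t' k B H' HG'. apply (infer_univ f IH f G' t' (fun _ => k)) in H'; auto.
    destruct H' as [i [_ H']]. eauto. }
  assert (app : forall t u, bind (infer consts tab f G t) (fun T =>
        match T with
        | cPi A B => if check consts tab f G u A then Some (csubst1 u B) else None
        | _ =>
          match whnf tab f T with
          | cPi A B =>
              bind (infer consts tab f G (cPi A B)) (fun S1 => as_univ tab f S1 (fun i =>
              if check consts tab f G u A then Some (csubst1 u B) else None))
          | _ => None
          end
        end) = Some A -> (map e G ⊢ e (cApp t u) ∈ e A) /\ is_type G A).
  { clear H t. intros t u H. apply bind_Some in H as [T [H1 H]].
    apply IH in H1 as [H1 HT]; auto.
    assert (pi : forall X Y, map e G ⊢ e t ∈ Pi (e X) (e Y) -> is_type G (cPi X Y) ->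
      (if check consts tab f G u X then Some (csubst1 u Y) else None) = Some A ->
      (map e G ⊢ e (cApp t u) ∈ e A) /\ is_type G A).
    { intros X Y Ht HP H'. apply is_Pi in HP as [HX [HY _]]; auto.
      apply if_Some in H' as [H2 H']. apply IC in H2; auto.
      injection H' as <-. split; [|eapply is_type_subst1; eauto].
      rewrite erase_subst1. eapply ty_App; eauto. }
    assert (whn : match whnf tab f T with
          | cPi A B =>
              bind (infer consts tab f G (cPi A B)) (fun S1 => as_univ tab f S1 (fun i =>
              if check consts tab f G u A then Some (csubst1 u B) else None))
          | _ => None
          end = Some A -> (map e G ⊢ e (cApp t u) ∈ e A) /\ is_type G A).
    { clear H. intros H. assert (W := whnf_sound f T).
      destruct (whnf tab f T) as [| |X Y| | | | |]; try discriminate.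
      apply univ in H as [i [Hi H]]; auto.
      apply (pi X Y); auto; [|exists i; auto]. eapply ty_conv; eauto. }
    destruct T as [| |X Y| | | | |]; try (apply whn; exact H). apply (pi X Y); auto. }
  destruct t as [n|i|X Y|[X|] b|t u|c i j|t X|s];
    cbn -[nth_error Nat.max existsb emb closed cst_type] in H.
  - destruct (nth_error G n) as [B|] eqn:Hn; [|discriminate]. injection H as <-.
    assert (Hn' : nth_error (map e G) n = Some (e B)) by (rewrite nth_error_map, Hn; auto).
    unfold is_type, clift. rewrite erase_ren. split; [apply ty_Var; auto|].
    apply (wf_nth _ HG _ _ Hn').
  - injection H as <-. split; [apply ty_Univ; auto|apply is_univ; auto].
  - apply univ in H as [i [HX H]]; auto.
    apply univ in H as [j [HY H]]; [|simpl; econstructor; eauto].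
    injection H as <-. split; [|apply is_univ; auto]. simpl.
    apply ty_Pi; eapply ty_cumul_le; eauto; lia.
  - apply univ in H as [i [HX H]]; auto.
    apply bind_Some in H as [Y [H1 H]]. injection H as <-.
    destruct (IH _ _ _ H1) as [Hb [j HY]]; [simpl; econstructor; eauto|]. simpl.
    split; [apply ty_Lam; auto|]. exists (max i j).
    simpl. apply ty_Pi; eapply ty_cumul_le; eauto; lia.
  - discriminate.
  - assert (V := view_sound E t u).
    destruct (view t u) as [X x y|X Y|X Y|X|b|].
    + apply univ in H as [k [HX H]]; auto.
      assert (is_type G X) by (exists k; auto).
      apply if_Some in H as [H1 H]. apply IC in H1; auto.
      apply if_Some in H as [H2 H]. apply IC in H2; auto.
      injection H as <-. split; [|apply is_univ; auto]. rewrite V. apply ty_Id; auto.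
    + apply univ in H as [k [HX H]]; auto.
      apply univ in H as [l [HY H]]; [|simpl; econstructor; eauto].
      injection H as <-. split; [|apply is_univ; auto]. rewrite V.
      apply ty_Sigma; auto; eapply ty_cumul_le; eauto; lia.
    + apply univ in H as [k [HX H]]; auto.
      apply univ in H as [l [HY H]]; auto.
      injection H as <-. split; [|apply is_univ; auto]. rewrite V.
      apply ty_Sum; auto; eapply ty_cumul_le; eauto; lia.
    + apply univ in H as [k [HX H]]; auto. injection H as <-.
      split; [|apply is_univ; auto]. destruct V as [c [Hc ->]].
      apply (ty_App _ (Univ k) (Univ k)); auto. rewrite <- (Hc k 0). apply ty_Cst; auto.
    + apply bind_Some in H as [X [H1 H]]. apply bind_Some in H as [Y [H2 H]].
      injection H as <-. destruct (IH _ _ _ H1) as [Hu [k HX]]; auto.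
      destruct (IH _ _ _ H2) as [Hb HY]; [simpl; econstructor; eauto|].
      split; [|eapply is_type_subst1; eauto].
      rewrite V, erase_subst1. eapply ty_App; [apply ty_Lam, Hb|exact Hu].
    + apply app. exact H.
  - destruct existsb eqn:X; [|discriminate]. injection H as <-.
    apply existsb_exists in X as [[[c' i'] j'] [Hin Q]]. unfold eq_level in Q.
    rewrite !andb_true_iff in Q. destruct Q as [[Q1 Q2] Q3].
    unfold cst_eqb in Q1. destruct cst_eq_dec; [|discriminate].
    apply Nat.eqb_eq in Q2, Q3. subst.
    unfold is_type. rewrite erase_emb. split; [apply ty_Cst; auto|].
    destruct (consts_ok _ _ _ Hin) as [k Hk]. exists k.
    eapply typing_weaken_closed; eauto. apply ty_Univ. constructor.
  - apply univ in H as [k [HX H]]; auto.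
    assert (is_type G X) by (exists k; auto).
    apply if_Some in H as [H1 H]. apply IC in H1; auto. injection H as <-. auto.
  - destruct (lookup tab s) as [[b B]|] eqn:L; [|discriminate]. injection H as <-.
    apply E_tab in L as [_ [H [i Hi]]]. split; [simpl; eapply typing_weaken_closed; eauto|].
    exists i. eapply typing_weaken_closed; eauto. apply ty_Univ. constructor.
Qed.

Lemma checker_sound f : infer_ok f /\ check_ok f.
Proof.
  induction f as [|f [IH IC]].
  - split; red; discriminate.
  - split; auto using infer_step, check_step.
Qed.
End Soundness.

(** * Tables of definitions and lists of constants *)

Fixpoint names_in (T : table) (t : ctm) : bool :=
  match t with
  | cPi A B => names_in T A && names_in T B
  | cLam _ t => names_in T t
  | cApp t u => names_in T t && names_in T u
  | cAnn t _ => names_in T t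
  | cDef s => match lookup T s with Some _ => true | None => false end
  | _ => true
  end.

Definition check_type (f : nat) K (T : table) (A : ctm) : bool :=
  match infer K T f [] A with
  | Some B => match whnf T f B with cUniv _ => true | _ => false end
  | None => false
  end.

Definition check_entry (f : nat) K (T : table) (s : string) (t A : ctm) : bool :=
  match lookup T s with Some _ => false | None => true end &&
  names_in T t && names_in T A && check_type f K T A &&
  check K T f [] t A.

Fixpoint check_table (f : nat) K (T : table) : bool :=
  match T with
  | [] => true
  | (s, (t, A)) :: T => check_table f K T && check_entry f K T s t A
  end.

Fixpoint check_consts (f : nat) (K : list (cst * nat * nat)) : bool :=
  match K with
  | [] => true
  | (c, i, j) :: K =>
      check_consts f K && check_type f K [] (emb (closed (cst_type c i j)))
  end.

Lemma erase_agree E E' T t :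
  names_in T t = true ->
  (forall s, lookup T s <> None -> E s = E' s) -> erase E t = erase E' t.
Proof.
  intros H HE. revert H.
  induction t as [n|i|A IHA B IHB|o t IHt|t IHt u IHu|c i j|t IHt A IHA|s]; simpl; intros H;
    try (apply andb_true_iff in H as []); try (f_equal; auto; fail); auto.
  apply HE. destruct (lookup T s); discriminate.
Qed.

Definition valid (T : table) : Prop :=
  (forall s, scoped 0 (meaning T s)) /\
  forall s b A, lookup T s = Some (b, A) ->
    meaning T s = erase (meaning T) b /\
    ([] ⊢ meaning T s ∈ erase (meaning T) A) /\
    (exists i, [] ⊢ erase (meaning T) A ∈ Univ i) /\
    names_in T b = true /\ names_in T A = true.

Lemma names_in_cons T s e t :
  names_in T t = true -> names_in ((s, e) :: T) t = true.
Proof.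
  induction t; simpl; intros H; auto;
    try (apply andb_true_iff in H as []; apply andb_true_iff; auto).
  destruct String.eqb; auto.
Qed.

Lemma check_type_sound f K T E A :
  (forall c i j, In (c, i, j) K -> exists k, [] ⊢ closed (cst_type c i j) ∈ Univ k) ->
  (forall s, scoped 0 (E s)) ->
  (forall s b A, lookup T s = Some (b, A) ->
    E s = erase E b /\ ([] ⊢ E s ∈ erase E A) /\ exists i, [] ⊢ erase E A ∈ Univ i) ->
  check_type f K T A = true -> exists k, [] ⊢ erase E A ∈ Univ k.
Proof.
  intros HK HE HT H. unfold check_type in H.
  destruct (infer K T f [] A) as [B|] eqn:I; [|discriminate].
  destruct (checker_sound K T E HK HE HT f) as [SI _].
  destruct (SI _ _ _ I wf_nil) as [HA _].
  assert (W := whnf_sound T E HE HT f B).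
  destruct (whnf T f B) as [|k| | | | | |]; try discriminate.
  exists k. eapply ty_conv; [exact HA|exact W|]. apply ty_Univ. constructor.
Qed.

Lemma check_consts_sound f K : check_consts f K = true ->
  forall c i j, In (c, i, j) K -> exists k, [] ⊢ closed (cst_type c i j) ∈ Univ k.
Proof.
  induction K as [|[[c i] j] K IH]; simpl; intros H c' i' j' []; 
    apply andb_true_iff in H as [HK H]; [|eauto].
  injection H0 as <- <- <-. 
  (* The type of a constant was checked against the constants after it and without definitions, so
     any closed meaning of the names will do. *)
  destruct (check_type_sound f K [] (fun _ => Univ 0)
              (emb (closed (cst_type c i j)))) as [k Hk]; auto.
  - simpl; auto.
  - discriminate.
  - rewrite erase_emb in Hk. eauto.
Qed.

Lemma check_table_sound f K T :
  (forall c i j, In (c, i, j) K -> exists k, [] ⊢ closed (cst_type c i j) ∈ Univ k) ->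
  check_table f K T = true -> valid T.
Proof.
  intros HK. induction T as [|[s [t A]] T IH]; simpl; intros H.
  - split; [simpl; auto|]. discriminate.
  - apply andb_true_iff in H as [HT H]. specialize (IH HT) as V. clear IH HT.
    destruct V as [Vc V].
    assert (W : forall s b A, lookup T s = Some (b, A) ->
      meaning T s = erase (meaning T) b /\ ([] ⊢ meaning T s ∈ erase (meaning T) A) /\
      exists i, [] ⊢ erase (meaning T) A ∈ Univ i) by (intros; edestruct V; intuition eauto).
    unfold check_entry in H. rewrite !andb_true_iff in H.
    destruct H as [[[[H1 H2] H3] H4] H5].
    destruct (lookup T s) as [|] eqn:L; [discriminate|]. clear H1.
    destruct (check_type_sound _ _ _ _ _ HK Vc W H4) as [k IA].
    destruct (checker_sound K T (meaning T) HK Vc W f) as [_ SC].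
    assert (It := SC _ _ _ H5 wf_nil (ex_intro _ k IA)). clear H5 SC.
    (* The new name is fresh and shadows nothing, so terms over the old table keep their meaning. *)
    assert (X : forall s', lookup T s' <> None ->
                  meaning ((s, (t, A)) :: T) s' = meaning T s').
    { intros s' Hs'. simpl. destruct (String.eqb_spec s' s); auto. congruence. }
    assert (Y : forall u, names_in T u = true ->
                  erase (meaning ((s, (t, A)) :: T)) u = erase (meaning T) u).
    { intros u Hu. eapply erase_agree; eauto. }
    split.
    + intros s'. simpl. destruct String.eqb; auto. apply typing_scoped in It. exact It.
    + intros s' b B' Hs'. simpl in Hs'. destruct (String.eqb_spec s' s) as [->|N].
      * injection Hs' as <- <-. rewrite !Y by auto.
        simpl meaning. rewrite String.eqb_refl. intuition eauto using names_in_cons.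
      * destruct (V _ _ _ Hs') as [V1 [V2 [[i V3] [V4 V5]]]].
        rewrite !Y by auto. rewrite X by congruence.
        intuition eauto using names_in_cons.
Qed.

Lemma check_table_provable f K T s b A :
  check_consts f K = true -> check_table f K T = true -> lookup T s = Some (b, A) ->
  exists t, [] ⊢ t ∈ erase (meaning T) A.
Proof.
  intros HK H L. apply check_table_sound in H as [_ H]; [|eapply check_consts_sound; eauto].
  apply H in L as [_ [L _]]. eauto.
Qed.

(** * The object language *)

Module Terms.

(* The index of [Tm] is the intended object-level type.  It guides the
   elaboration of implicit arguments and is not trusted: the checker sees only
   [raw]. *)
Definition cexpr : Type := nat -> ctm.

Record Tm (A : cexpr) : Type := mk { raw : cexpr }.
Arguments mk {A}.
Arguments raw {A}.
Coercion raw : Tm >-> cexpr.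

Definition cU : cexpr := fun _ => cUniv 3.
Notation Ty := (Tm cU).
Definition type : Ty := mk cU.
Definition univ (i : nat) : Ty := mk (fun _ => cUniv i).
(** Universes are a la Russell, so [El] and [code] change only the index. *)
Definition El {i} (A : Tm (univ i)) : Ty := mk (raw A).
Definition code {i} (A : Ty) : Tm (univ i) := mk (raw A).

Definition cvar (n : nat) : cexpr := fun m => cVar (m - S n).

Definition prod (A : Ty) (B : Tm A -> Ty) : Ty :=
  mk (fun n => cPi (raw A n) (raw (B (mk (cvar n))) (S n))).
Definition abs {A : Ty} {B : Tm A -> Ty} (f : forall x, Tm (B x)) : Tm (prod A B) :=
  mk (fun n => cLam (Some (raw A n)) (raw (f (mk (cvar n))) (S n))).
Arguments abs {A B} & f.
Definition app {A : Ty} {B : Tm A -> Ty} (f : Tm (prod A B)) (a : Tm A) : Tm (B a) :=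
  mk (fun n => cApp (raw f n) (raw a n)).
(* Object-level conversion is not Rocq conversion.  [coe] only changes the index,
   [cast] also records the new type for the checker. *)
Definition cast {A B : cexpr} (t : Tm A) : Tm B := mk (fun n => cAnn (raw t n) (B n)).
Definition coe {A B : cexpr} (t : Tm A) : Tm B := mk (raw t).
(** Only the type of [t] survives: each definition is checked once, in the table, and later terms
    refer to it by name. *)
Definition named {A : Ty} (s : string) (t : Tm A) : Tm A := mk (fun _ => cDef s).
Definition entry {A : Ty} (s : string) (t : Tm A) : string * (ctm * ctm) :=
  (s, (raw t 0, raw A 0)).

Declare Scope lf_scope.
Delimit Scope lf_scope with lf.
Bind Scope lf_scope with Tm.
Local Open Scope lf_scope.

Notation "f · x" := (app f x) (at level 36, left associativity) : lf_scope.
Notation "A ⇒ B" := (prod A (fun _ => B))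
  (at level 56, right associativity) : lf_scope.
Notation "'Π' x : A , B" := (prod A (fun x => B))
  (at level 200, x name, A at level 150, B at level 200) : lf_scope.
Notation "'λ' x , t" := (abs (fun x => t))
  (at level 200, x name, t at level 200) : lf_scope.

Definition fam {A : Ty} (B : Tm A -> Ty) : Tm (A ⇒ type) :=
  abs (B := fun _ => type) B.

Definition capps (c : cst) (i j : nat) (l : list cexpr) : cexpr :=
  fun n => fold_left (fun t (u : cexpr) => cApp t (u n)) l (cCst c i j).
Definition prim {A : cexpr} (c : cst) (l : list cexpr) : Tm A := mk (capps c 3 3 l).

Definition eq {A : Ty} (x y : Tm A) : Ty := prim Id [raw A; raw x; raw y].
Notation "x ≈ y" := (eq x y) (at level 50, no associativity) : lf_scope.
Definition rfl {A : Ty} (x : Tm A) : Tm (x ≈ x) := prim refl [raw A; raw x].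
Definition ind_eq {A : Ty} {a : Tm A} (P : forall b, Tm (a ≈ b) -> Ty)
    (d : Tm (P a (rfl a))) {b : Tm A} (p : Tm (a ≈ b)) : Tm (P b p) :=
  cast (A := cU) (prim J [raw A; raw a;
    raw (abs (B := fun b => a ≈ b ⇒ type) (fun b => fam (P b))); raw d; raw b; raw p]).

Definition sigma (A : Ty) (B : Tm (A ⇒ type)) : Ty := prim Sigma [raw A; raw B].
Notation "'Σ' x : A , B" := (sigma A (fam (fun x => B)))
  (at level 200, x name, A at level 150, B at level 200) : lf_scope.
Definition dpair {A : Ty} {B : Tm A -> Ty} (a : Tm A) (b : Tm (B a)) : Tm (Σ x : A, B x) :=
  prim pair [raw A; raw (fam B); raw a; raw b].
Arguments dpair {A B} & a b.
Notation "⟨ a , b ⟩" := (dpair a b) (at level 0, a at level 99, b at level 99) : lf_scope.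
Definition ind_sigma {A : Ty} {B : Tm (A ⇒ type)} (P : Tm (sigma A B) -> Ty)
    (f : forall a (b : Tm (B · a)), Tm (P (prim pair [raw A; raw B; raw a; raw b])))
    (s : Tm (sigma A B)) : Tm (P s) :=
  cast (A := cU) (prim indSigma [raw A; raw B; raw (fam P);
    raw (abs (B := fun a => Π b : B · a, P (prim pair [raw A; raw B; raw a; raw b]))
           (fun a => abs (fun b => f a b))); raw s]).

(** * Projections and the groupoid structure of paths *)

Definition proj1_ : Tm (Π A : type, Π B : A ⇒ type, sigma A B ⇒ A) :=
  λ A, λ B, λ s, ind_sigma (fun _ => A) (fun a b => a) s.
Definition proj1 := named "proj1" proj1_.
Definition proj2_ : Tm (Π A : type, Π B : A ⇒ type, Π s : sigma A B, B · (proj1 · A · B · s)) :=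
  λ A, λ B, λ s, ind_sigma (fun s => B · (proj1 · A · B · s)) (fun a b => cast b) s.
Definition proj2 := named "proj2" proj2_.
Definition fst {A : Ty} {B : Tm A -> Ty} (s : Tm (Σ x : A, B x)) : Tm A :=
  proj1 · A · fam B · s.
Definition snd {A : Ty} {B : Tm A -> Ty} (s : Tm (Σ x : A, B x)) : Tm (B (fst s)) :=
  cast (proj2 · A · fam B · s).

(** Induction on the second path makes [p • rfl y] convertible to [p]. Many casts below rely on
    this. *)
Definition concat_ : Tm (Π A : type, Π x : A, Π y : A, Π z : A, x ≈ y ⇒ y ≈ z ⇒ x ≈ z) :=
  λ A, λ x, λ y, λ z, λ p, λ q, ind_eq (fun z _ => x ≈ z) p q.
Definition concat {A : Ty} {x y z : Tm A} (p : Tm (x ≈ y)) (q : Tm (y ≈ z)) : Tm (x ≈ z) :=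
  named "concat" concat_ · A · x · y · z · p · q.
Notation "p • q" := (concat p q) (at level 40, left associativity) : lf_scope.

Definition inverse_ : Tm (Π A : type, Π x : A, Π y : A, x ≈ y ⇒ y ≈ x) :=
  λ A, λ x, λ y, λ p, ind_eq (fun z _ => z ≈ x) (rfl x) p.
Definition inverse {A : Ty} {x y : Tm A} (p : Tm (x ≈ y)) : Tm (y ≈ x) :=
  named "inverse" inverse_ · A · x · y · p.
Notation "p ^" := (inverse p) (at level 30, format "p '^'") : lf_scope.

Definition ap_ : Tm (Π A : type, Π B : type, Π f : A ⇒ B, Π x : A, Π y : A,
    x ≈ y ⇒ f · x ≈ f · y) :=
  λ A, λ B, λ f, λ x, λ y, λ p, ind_eq (fun y _ => f · x ≈ f · y) (rfl (f · x)) p.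
Definition ap {A B : Ty} (f : Tm A -> Tm B) {x y : Tm A} (p : Tm (x ≈ y)) : Tm (f x ≈ f y) :=
  cast (named "ap" ap_ · A · B · (λ x, f x) · x · y · p).

Definition transport_ : Tm (Π A : type, Π P : A ⇒ type, Π x : A, Π y : A,
    x ≈ y ⇒ P · x ⇒ P · y) :=
  λ A, λ P, λ x, λ y, λ p, ind_eq (fun y _ => P · x ⇒ P · y) (λ u, u) p.
Definition transport {A : Ty} (P : Tm A -> Ty) {x y : Tm A} (p : Tm (x ≈ y))
    (u : Tm (P x)) : Tm (P y) :=
  cast (named "transport" transport_ · A · fam P · x · y · p · cast u).

Definition concat_1p_ : Tm (Π A : type, Π x : A, Π y : A, Π p : x ≈ y, rfl x • p ≈ p) :=
  λ A, λ x, λ y, λ p, ind_eq (fun y p => rfl x • p ≈ p) (cast (rfl (rfl x))) p.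
Definition concat_1p := named "concat_1p" concat_1p_.

Definition ap_concat_ : Tm (Π A : type, Π B : type, Π f : A ⇒ B,
    Π x : A, Π y : A, Π z : A, Π p : x ≈ y, Π q : y ≈ z,
    ap (app f) p • ap (app f) q ≈ ap (app f) (p • q)) :=
  λ A, λ B, λ f, λ x, λ y, λ z, λ p, λ q,
  ind_eq (fun z q => ap (app f) p • ap (app f) q ≈ ap (app f) (p • q))
    (cast (rfl (ap (app f) p))) q.

Definition ap_concat3_ : Tm (Π A : type, Π B : type, Π f : A ⇒ B,
    Π x : A, Π y : A, Π z : A, Π v : B, Π p : x ≈ y, Π q : y ≈ z, Π c : f · z ≈ v,
    ap (app f) p • (ap (app f) q • c) ≈ ap (app f) (p • q) • c) :=
  λ A, λ B, λ f, λ x, λ y, λ z, λ v, λ p, λ q, λ c,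
  ind_eq (fun v c => ap (app f) p • (ap (app f) q • c) ≈ ap (app f) (p • q) • c)
    (cast (named "ap_concat" ap_concat_ · A · B · f · x · y · z · p · q)) c.

Definition whisker {A : Ty} {x y z : Tm A} {p q : Tm (x ≈ y)} (h : Tm (p ≈ q)) (r : Tm (y ≈ z))
  : Tm (p • r ≈ q • r) := ap (fun p => p • r) h.
Notation "h ⋆ r" := (whisker h r) (at level 38, left associativity) : lf_scope.

Definition cancel_pV_ : Tm (Π X : type, Π x : X, Π y : X, Π z : X, Π a : y ≈ z, Π p : x ≈ y,
    p ≈ p • a • a^) :=
  λ X, λ x, λ y, λ z, λ a,
  ind_eq (fun z a => Π p : x ≈ y, p ≈ p • a • a^) (λ p, cast (rfl p)) a.
Definition cpV {X : Ty} {x y z : Tm X} (a : Tm (y ≈ z)) (p : Tm (x ≈ y)) : Tm (p ≈ p • a • a^) :=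
  named "cancel_pV" cancel_pV_ · X · x · y · z · a · p.
Definition cancel_Vp_ : Tm (Π X : type, Π x : X, Π y : X, Π z : X, Π a : y ≈ z, Π p : x ≈ z,
    p ≈ p • a^ • a) :=
  λ X, λ x, λ y, λ z, λ a,
  ind_eq (fun z a => Π p : x ≈ z, p ≈ p • a^ • a) (λ p, cast (rfl p)) a.
Definition cVp {X : Ty} {x y z : Tm X} (a : Tm (y ≈ z)) (p : Tm (x ≈ z)) : Tm (p ≈ p • a^ • a) :=
  named "cancel_Vp" cancel_Vp_ · X · x · y · z · a · p.

(** This and the next are the triangle identities of the adjoint equivalence formed by composition
    with [a] and with [a^]. *)
Definition cancel_pVp_ : Tm (Π X : type, Π x : X, Π y : X, Π z : X, Π a : y ≈ z, Π p : x ≈ y,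
    cVp a (p • a) ≈ cpV a p ⋆ a) :=
  λ X, λ x, λ y, λ z, λ a,
  ind_eq (fun z a => Π p : x ≈ y, cVp a (p • a) ≈ cpV a p ⋆ a) (λ p, cast (rfl (rfl p))) a.
Definition cancel_VpV_ : Tm (Π X : type, Π x : X, Π y : X, Π z : X, Π a : y ≈ z, Π p : x ≈ z,
    cpV a (p • a^) ≈ cVp a p ⋆ a^) :=
  λ X, λ x, λ y, λ z, λ a,
  ind_eq (fun z a => Π p : x ≈ z, cpV a (p • a^) ≈ cVp a p ⋆ a^) (λ p, cast (rfl (rfl p))) a.

(** What becomes of [q] when [a] and then [a^] is appended and the pair is cancelled; this serves to
    show that two shifts are mutually inverse. *)
Definition pull_push_ : Tm (Π X : type, Π x : X, Π y : X, Π z : X, Π a : y ≈ z,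
    Π p : x ≈ y, Π r : x ≈ y, Π q : p ≈ r,
    cpV a p • ((q ⋆ a) ⋆ a^ • (cpV a r)^) ≈ q) :=
  λ X, λ x, λ y, λ z, λ a,
  ind_eq (fun z a => Π p : x ≈ y, Π r : x ≈ y, Π q : p ≈ r,
            cpV a p • ((q ⋆ a) ⋆ a^ • (cpV a r)^) ≈ q)
    (λ p, λ r, λ q, cast (ind_eq (fun r q =>
            cpV (rfl y) p • ((q ⋆ rfl y) ⋆ (rfl y)^ • (cpV (rfl y) r)^) ≈ q) (cast (rfl (rfl p))) q)) a.

(** The same with [a^] appended first. Once [a] is [rfl y], the endpoint [r • a] of [q] is
    convertible to the variable [r], which makes induction on [q] possible. *)
Definition push_pull_ : Tm (Π X : type, Π x : X, Π y : X, Π z : X, Π a : y ≈ z,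
    Π r : x ≈ y, Π p : x ≈ z, Π q : p ≈ r • a,
    cVp a p • ((q ⋆ a^ • (cpV a r)^) ⋆ a) ≈ q) :=
  λ X, λ x, λ y, λ z, λ a,
  ind_eq (fun z a => Π r : x ≈ y, Π p : x ≈ z, Π q : p ≈ r • a,
            cVp a p • ((q ⋆ a^ • (cpV a r)^) ⋆ a) ≈ q)
    (λ r, λ p, λ q, cast (ind_eq (a := p) (fun r q =>
            cVp (rfl y) p • (((cast q : Tm (p ≈ r • rfl y)) ⋆ (rfl y)^ • (cpV (rfl y) r)^) ⋆ rfl y) ≈ cast q)
            (cast (rfl (rfl p))) (b := r) (cast q))) a.

(** * Equivalences, function extensionality and univalence *)

Definition Rinv {A B : Ty} (f : Tm (A ⇒ B)) : Ty := Σ g : B ⇒ A, Π b : B, f · (g · b) ≈ b.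
Definition Linv {A B : Ty} (f : Tm (A ⇒ B)) : Ty := Σ h : B ⇒ A, Π a : A, h · (f · a) ≈ a.
Definition Isequiv {A B : Ty} (f : Tm (A ⇒ B)) : Ty := Σ r : Rinv f, Linv f.
Definition Equiv (A B : Ty) : Ty := Σ f : A ⇒ B, Isequiv f.
Definition mk_equiv {A B : Ty} (f : Tm (A ⇒ B)) (g : Tm (B ⇒ A))
    (s : Tm (Π b : B, f · (g · b) ≈ b)) (r : Tm (Π a : A, g · (f · a) ≈ a)) :
    Tm (Equiv A B) :=
  ⟨f, dpair (A := Rinv f) (B := fun _ => Linv f)
        (dpair (B := fun g => Π b : B, f · (g · b) ≈ b) g s)
        (dpair (B := fun g => Π a : A, g · (f · a) ≈ a) g r)⟩.

Definition equiv_inv_ : Tm (Π A : type, Π B : type, Π f : A ⇒ B, Isequiv f ⇒ B ⇒ A) :=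
  λ A, λ B, λ f, λ e, fst (fst e).

Definition happly {A : Ty} {B : Tm (A ⇒ type)} (f g : Tm (Π x : A, B · x)) :
    Tm ((f ≈ g) ⇒ Π x : A, f · x ≈ g · x) :=
  λ p, ind_eq (fun h _ => Π x : A, f · x ≈ h · x) (λ x, rfl (f · x)) p.

Definition funext_ : Tm (Π A : type, Π B : A ⇒ type,
    Π f : (Π x : A, B · x), Π g : (Π x : A, B · x), (Π x : A, f · x ≈ g · x) ⇒ f ≈ g) :=
  λ A, λ B, λ f, λ g, named "equiv_inv" equiv_inv_ · (f ≈ g) · (Π x : A, f · x ≈ g · x) ·
    happly f g · prim funext [raw A; raw B; raw f; raw g].
Definition fun_ext {A : Ty} {B : Tm A -> Ty} {f g : Tm (Π x : A, B x)}
    (h : forall x, Tm (f · x ≈ g · x)) : Tm (f ≈ g) :=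
  coe (named "funext" funext_ · A · fam B · coe f · coe g · coe (λ x, h x)).

Definition id_equiv (A : Ty) : Tm (Equiv A A) :=
  mk_equiv (λ x, x) (λ x, x) (λ b, coe (rfl b)) (λ a, coe (rfl a)).
Definition idtoeqv {i} (A B : Tm (univ i)) : Tm ((A ≈ B) ⇒ Equiv (El A) (El B)) :=
  λ p, ind_eq (fun X _ => Equiv (El A) (El X)) (id_equiv (El A)) p.
Definition ua_ (i : nat) : Tm (Π A : univ i, Π B : univ i, Equiv (El A) (El B) ⇒ A ≈ B) :=
  λ A, λ B, named "equiv_inv" equiv_inv_ · (A ≈ B) · Equiv (El A) (El B) · idtoeqv A B ·
    mk (capps univalence i 0 [raw A; raw B]).

(** * Propositions and propositional truncation *)

Definition isprop (A : Ty) : Ty := Π x : A, Π y : A, x ≈ y.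

Definition pi_prop_ : Tm (Π A : type, Π B : A ⇒ type, (Π x : A, isprop (B · x)) ⇒
    isprop (Π x : A, B · x)) :=
  λ A, λ B, λ h, λ f, λ g, fun_ext (fun x => h · x · (f · x) · (g · x)).
Definition pi_prop {A : Ty} {B : Tm A -> Ty} (h : forall x, Tm (isprop (B x))) :
    Tm (isprop (Π x : A, B x)) :=
  coe (named "pi_prop" pi_prop_ · A · fam B · coe (λ x, h x)).

Definition prod_prop_ : Tm (Π A : type, Π B : type, isprop A ⇒ isprop B ⇒ isprop (Σ x : A, B)) :=
  λ A, λ B, λ hA, λ hB, λ s, λ t,
  ind_sigma (fun s => s ≈ t) (fun a b =>
    ind_sigma (fun t => ⟨a, coe b⟩ ≈ t) (fun a' b' =>
      ap (fun a => ⟨a, coe b⟩) (hA · a · a') • ap (fun b => ⟨a', b⟩) (hB · coe b · coe b')) t) s.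
Definition prod_prop {A B : Ty} (hA : Tm (isprop A)) (hB : Tm (isprop B)) :
    Tm (isprop (Σ x : A, B)) := named "prod_prop" prod_prop_ · A · B · hA · hB.

Definition concat_Vp_ : Tm (Π A : type, Π x : A, Π y : A, Π p : x ≈ y, rfl y ≈ p^ • p) :=
  λ A, λ x, λ y, λ p, ind_eq (fun y p => rfl y ≈ p^ • p) (coe (rfl (rfl x))) p.

(** By induction every [p : x ≈ y] equals [(h · x · x)^ • (h · x · y)], an expression in which [p]
    does not occur. *)
Definition prop_set_ : Tm (Π A : type, isprop A ⇒
    Π x : A, Π y : A, Π p : x ≈ y, Π q : x ≈ y, p ≈ q) :=
  λ A, λ h, λ x, λ y, λ p, λ q,
  let c y (p : Tm (x ≈ y)) : Tm (p ≈ (h · x · x)^ • (h · x · y)) :=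
    ind_eq (fun y p => p ≈ (h · x · x)^ • (h · x · y))
      (named "concat_Vp" concat_Vp_ · A · x · x · (h · x · x)) p in
  c y p • (c y q)^.
Definition prop_set {A : Ty} (h : Tm (isprop A)) {x y : Tm A} (p q : Tm (x ≈ y)) : Tm (p ≈ q) :=
  named "prop_set" prop_set_ · A · h · x · y · p · q.

Definition isprop_isprop_ : Tm (Π A : type, isprop (isprop A)) :=
  λ A, λ f, λ g, fun_ext (fun x => fun_ext (fun y => prop_set f (f · x · y) (g · x · y))).

Definition opair {A : Ty} {B : Tm (A ⇒ type)} (a : Tm A) (b : Tm (B · a)) : Tm (sigma A B) :=
  prim pair [raw A; raw B; raw a; raw b].

Definition subtype_ : Tm (Π A : type, Π B : A ⇒ type, (Π a : A, isprop (B · a)) ⇒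
    Π s : sigma A B, Π t : sigma A B, proj1 · A · B · s ≈ proj1 · A · B · t ⇒ s ≈ t) :=
  λ A, λ B, λ h, λ s, λ t,
  ind_sigma (fun s => proj1 · A · B · s ≈ proj1 · A · B · t ⇒ s ≈ t) (fun a b =>
    ind_sigma (fun t => proj1 · A · B · opair a b ≈ proj1 · A · B · t ⇒ opair a b ≈ t)
      (fun a' b' => λ p,
        ind_eq (fun a' _ => Π b' : B · a', opair a b ≈ opair a' b')
          (λ b', ap (fun b => opair a b) (h · a · b · b')) (coe p : Tm (a ≈ a')) · b') t) s.
Definition subtype_eq {A : Ty} {B : Tm A -> Ty} (h : forall a, Tm (isprop (B a)))
    {s t : Tm (Σ x : A, B x)} (p : Tm (fst s ≈ fst t)) : Tm (s ≈ t) :=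
  named "subtype" subtype_ · A · fam B · coe (λ a, h a) · s · t · p.

Definition hProp : Ty := Σ X : univ 0, isprop (El X).
Definition holds (X : Tm hProp) : Ty := El (fst X).
Definition holds_prop (X : Tm hProp) : Tm (isprop (holds X)) := snd X.

Definition prop_ext_ : Tm (Π X : hProp, Π Y : hProp,
    (holds X ⇒ holds Y) ⇒ (holds Y ⇒ holds X) ⇒ X ≈ Y) :=
  λ X, λ Y, λ f, λ g,
  subtype_eq (B := fun X : Tm (univ 0) => isprop (El X))
    (fun X : Tm (univ 0) => named "isprop_isprop" isprop_isprop_ · El X)
    (named "ua0" (ua_ 0) · fst X · fst Y ·
      mk_equiv f g (λ y, holds_prop Y · (f · (g · y)) · y) (λ x, holds_prop X · (g · (f · x)) · x)).
Definition prop_ext {X Y : Tm hProp} (f : Tm (holds X ⇒ holds Y)) (g : Tm (holds Y ⇒ holds X)) :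
  Tm (X ≈ Y) := named "prop_ext" prop_ext_ · X · Y · f · g.

Definition Tr (A : Ty) : Ty := prim (Trunc 1) [raw A].
Definition tr1 {A : Ty} (a : Tm A) : Tm (Tr A) := prim (tr 1) [raw A; raw a].
Definition trunc_prop_ : Tm (Π A : type, isprop (Tr A)) :=
  λ A, λ x, λ y,
  fst (B := fun a => Π p : x ≈ y, a ≈ p)
    ((prim (istrunc 1) [raw A] : Tm (Π x : Tr A, Π y : Tr A, Σ a : x ≈ y, Π p : x ≈ y, a ≈ p))
       · x · y).
Definition trunc_prop (A : Ty) : Tm (isprop (Tr A)) := named "trunc_prop" trunc_prop_ · A.
Definition prop_hlevel {A : Ty} (h : Tm (isprop A)) :
    Tm (Π x : A, Π y : A, Σ a : x ≈ y, Π p : x ≈ y, a ≈ p) :=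
  λ x, λ y, ⟨h · x · y, λ p, prop_set h (h · x · y) p⟩.
Definition trunc_rec_ : Tm (Π A : type, Π B : type, isprop B ⇒ (A ⇒ B) ⇒ Tr A ⇒ B) :=
  λ A, λ B, λ h, λ f, λ t,
  cast (A := cU) (prim (indTrunc 1) [raw A; raw (fam (fun _ : Tm (Tr A) => B));
    raw ((λ t, prop_hlevel h) : Tm (Tr A ⇒ _)); raw f; raw t]).
Definition trunc_rec {A B : Ty} (h : Tm (isprop B)) (f : Tm A -> Tm B) (t : Tm (Tr A)) : Tm B :=
  named "trunc_rec" trunc_rec_ · A · B · h · (λ a, f a) · t.

(** * Basic inductive types and the wedge of circles *)

Definition Empty : Ty := prim Zero [].
Definition absurd {B : cexpr} (x : Tm Empty) : Tm B :=
  cast (A := cU) (prim indZero [raw (fam (fun _ : Tm Empty => mk B)); raw x]).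
Definition Unit : Ty := prim One [].
Definition tt : Tm Unit := prim star [].

Definition N : Ty := prim Nat [].
Definition zer : Tm N := prim zero [].
Definition suc (n : Tm N) : Tm N := prim succ [raw n].
Definition ind_nat (P : Tm N -> Ty) (z : Tm (P zer)) (s : forall n, Tm (P n) -> Tm (P (suc n)))
    (n : Tm N) : Tm (P n) :=
  cast (A := cU) (prim indNat [raw (fam P); raw z;
    raw (abs (B := fun n => P n ⇒ P (suc n)) (fun n => λ x, s n x)); raw n]).

Definition sum (A B : Ty) : Ty := prim Sum [raw A; raw B].
Definition in_l {A B : Ty} (a : Tm A) : Tm (sum A B) := prim inl [raw A; raw B; raw a].
Definition in_r {A B : Ty} (b : Tm B) : Tm (sum A B) := prim inr [raw A; raw B; raw b].
Definition ind_sum {A B : Ty} (s : Tm (sum A B)) (P : Tm (sum A B) -> Ty)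
    (f : forall a, Tm (P (in_l a))) (g : forall b, Tm (P (in_r b))) : Tm (P s) :=
  cast (A := cU) (prim indSum [raw A; raw B; raw (fam P);
    raw (abs (B := fun a => P (in_l a)) f); raw (abs (B := fun b => P (in_r b)) g); raw s]).

(* Recursion on pairs [(P n, P (n+1))], so that [ind2] computes on [n + 2]. *)
Definition ind2_ : Tm (Π P : N ⇒ type, P · zer ⇒ P · suc zer ⇒
    (Π n : N, P · n ⇒ P · suc (suc n)) ⇒ Π n : N, P · n) :=
  λ P, λ z, λ o, λ s, λ n,
  fst (ind_nat (fun n => Σ x : P · n, P · suc n) ⟨z, o⟩
         (fun n r => ⟨snd r, s · n · fst r⟩) n).
Definition ind2 (P : Tm N -> Ty) (z : Tm (P zer)) (o : Tm (P (suc zer)))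
    (s : forall n, Tm (P n) -> Tm (P (suc (suc n)))) (n : Tm N) : Tm (P n) :=
  cast (named "ind2" ind2_ · fam P · coe z · coe o ·
    coe (abs (B := fun n => P n ⇒ P (suc (suc n))) (fun n => λ x, s n x)) · n).

Notation Set0 := (Tm (univ 0)).

Definition W (A : Set0) : Ty := prim Wedge [raw A].
Definition pt (A : Set0) : Tm (W A) := prim base [raw A].
Definition gen {A : Set0} (a : Tm (El A)) : Tm (pt A ≈ pt A) := prim loop [raw A; raw a].
Definition F (A : Set0) : Ty := pt A ≈ pt A.

Definition Letter (A : Set0) : Ty := sum (El A) (El A).

(** * Words and deletions *)

(* [Matches l m]: the letter [m] is the inverse of [l].  Computed by cases, it is
   a path type of [A] or empty, hence visibly a proposition. *)
Definition matches_ : Tm (Π A : univ 0, Letter A ⇒ Letter A ⇒ univ 0) :=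
  λ A, λ l, λ m, ind_sum l (fun _ => univ 0)
    (fun a => ind_sum m (fun _ => univ 0) (fun b => code Empty) (fun b => code (a ≈ b)))
    (fun a => ind_sum m (fun _ => univ 0) (fun b => code (a ≈ b)) (fun b => code Empty)).
Definition Matches {A : Set0} (l m : Tm (Letter A)) : Ty := El (named "matches" matches_ · A · l · m).

Definition val_ : Tm (Π A : univ 0, Letter A ⇒ F A) :=
  λ A, λ l, ind_sum l (fun _ => F A) (fun a => gen a) (fun a => (gen a)^).
Definition val {A : Set0} (l : Tm (Letter A)) : Tm (F A) := named "val" val_ · A · l.

(** This is [hlevel 2] unfolded, so that after erasure it coincides with [isset] in the theorem. *)
Definition Isset (A : Ty) : Ty :=
  Π x : A, Π y : A, Π p : x ≈ y, Π q : x ≈ y, Σ c : p ≈ q, Π d : p ≈ q, c ≈ d.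

Definition matches_prop_ : Tm (Π A : univ 0, Isset (El A) ⇒ Π l : Letter A, Π m : Letter A,
    isprop (Matches l m)) :=
  λ A, λ h, λ l, λ m,
  let set_prop (a b : Tm (El A)) : Tm (isprop (a ≈ b)) := λ p, λ q, fst (h · a · b · p · q) in
  ind_sum l (fun l => isprop (Matches l m))
    (fun a => ind_sum m (fun m => isprop (Matches (in_l a) m))
       (fun b => λ p, λ q, absurd (coe p)) (fun b => coe (set_prop a b)))
    (fun a => ind_sum m (fun m => isprop (Matches (in_r a) m))
       (fun b => coe (set_prop a b)) (fun b => λ p, λ q, absurd (coe p))).

Definition cancel_ : Tm (Π A : univ 0, Π l : Letter A, Π m : Letter A, Matches l m ⇒
    Π p : F A, p ≈ p • val l • val m) :=
  λ A, λ l, λ m,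
  let P l m := Matches l m ⇒ Π p : F A, p ≈ p • val l • val m in
  ind_sum l (fun l => P l m)
    (fun a => ind_sum m (fun m => P (in_l a) m)
       (fun b => λ e, absurd (coe e))
       (fun b => λ e, ind_eq (fun b _ => Π p : F A, p ≈ p • val (in_l a) • val (in_r b))
                        (λ p, coe (cpV (gen a) p)) (coe e : Tm (a ≈ b))))
    (fun a => ind_sum m (fun m => P (in_r a) m)
       (fun b => λ e, ind_eq (fun b _ => Π p : F A, p ≈ p • val (in_r a) • val (in_l b))
                        (λ p, coe (cVp (gen a) p)) (coe e : Tm (a ≈ b)))
       (fun b => λ e, absurd (coe e))).
Definition cancel {A : Set0} {l m : Tm (Letter A)} (e : Tm (Matches l m)) (p : Tm (F A)) :
    Tm (p ≈ p • val l • val m) :=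
  named "cancel" cancel_ · A · l · m · e · p.

Definition cancel_nat_ : Tm (Π A : univ 0, Π l : Letter A, Π m : Letter A, Π e : Matches l m,
    Π p : F A, Π q : F A, Π k : p ≈ q,
    k • cancel e q ≈ cancel e p • (k ⋆ val l ⋆ val m)) :=
  λ A, λ l, λ m, λ e, λ p, λ q, λ k,
  ind_eq (fun q k => k • cancel e q ≈ cancel e p • (k ⋆ val l ⋆ val m))
    (coe (named "concat_1p" concat_1p_ · F A · p · (p • val l • val m) · cancel e p)) k.

(** Words are left-nested tuples of known length: the last letter is at hand, [eval (snoc u l)] is
    convertible to [eval u • val l], and the length serves as the induction measure. *)
Definition word_type_ : Tm (Π A : univ 0, N ⇒ univ 0) :=
  λ A, λ n, ind_nat (fun _ => univ 0) (code Unit) (fun n X => code (Σ x : El X, Letter A)) n.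
Definition Word (A : Set0) (n : Tm N) : Ty := El (named "word_type" word_type_ · A · n).
Definition snoc {A : Set0} {n : Tm N} (u : Tm (Word A n)) (l : Tm (Letter A)) : Tm (Word A (suc n)) :=
  coe ⟨u, l⟩.
Definition init {A : Set0} {n : Tm N} (u : Tm (Word A (suc n))) : Tm (Word A n) :=
  fst (coe u : Tm (Σ x : Word A n, Letter A)).
Definition last {A : Set0} {n : Tm N} (u : Tm (Word A (suc n))) : Tm (Letter A) :=
  snd (coe u : Tm (Σ x : Word A n, Letter A)).

Definition eval_ : Tm (Π A : univ 0, Π n : N, Word A n ⇒ F A) :=
  λ A, λ n, ind_nat (fun n => Word A n ⇒ F A) (λ u, rfl (pt A))
    (fun n d => λ u, d · init u • val (last u)) n.
Definition eval {A : Set0} {n : Tm N} (u : Tm (Word A n)) : Tm (F A) := named "eval" eval_ · A · n · u.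

(* [Red u] is the type of positions at which adjacent inverse letters can be
   deleted from [u]: at the end of [u], or, in [Initred (init u)], further left. *)
Definition initred_ : Tm (Π A : univ 0, Π n : N, Word A (suc n) ⇒ univ 0) :=
  λ A, λ n, ind_nat (fun n => Word A (suc n) ⇒ univ 0) (λ w, code Empty)
    (fun n R => λ w, code (sum (Matches (last (init w)) (last w)) (El (R · init w)))) n.
Definition Initred {A : Set0} {n : Tm N} (w : Tm (Word A (suc n))) : Ty :=
  El (named "initred" initred_ · A · n · w).
Definition Red {A : Set0} {n : Tm N} (u : Tm (Word A (suc (suc n)))) : Ty :=
  sum (Matches (last (init u)) (last u)) (Initred (init u)).

Definition delete_with {A : Set0} {n : Tm N}
    (rec : Tm (Π w : Word A (suc n), Initred w ⇒ Letter A ⇒ Word A n))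
    (u : Tm (Word A (suc (suc n)))) (r : Tm (Red u)) : Tm (Word A n) :=
  ind_sum r (fun _ => Word A n) (fun e => init (init u)) (fun r => rec · init u · r · last u).
(** The word [w] has [n + 1] letters and loses two. Appending [m], the letter that follows [w],
    makes the length [n] and avoids a predecessor in the index. *)
Definition initdelete_ : Tm (Π A : univ 0, Π n : N, Π w : Word A (suc n), Initred w ⇒ Letter A ⇒ Word A n) :=
  λ A, λ n, ind_nat (fun n => Π w : Word A (suc n), Initred w ⇒ Letter A ⇒ Word A n)
    (λ w, λ r, λ m, absurd (coe r))
    (fun n rec => λ w, λ r, λ m, snoc (delete_with rec w (coe r)) m) n.
Definition initdelete {A : Set0} {n : Tm N} (w : Tm (Word A (suc n))) (r : Tm (Initred w))
    (m : Tm (Letter A)) : Tm (Word A n) := named "initdelete" initdelete_ · A · n · w · r · m.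
Definition delete_ : Tm (Π A : univ 0, Π n : N, Π u : Word A (suc (suc n)), Red u ⇒ Word A n) :=
  λ A, λ n, λ u, λ r, delete_with (named "initdelete" initdelete_ · A · n) u r.
Definition delete {A : Set0} {n : Tm N} (u : Tm (Word A (suc (suc n)))) (r : Tm (Red u)) : Tm (Word A n) :=
  named "delete" delete_ · A · n · u · r.

Definition eval_delete_with {A : Set0} {n : Tm N}
    (rec : Tm (Π w : Word A (suc n), Π r : Initred w, Π m : Letter A,
               eval (initdelete w r m) ≈ eval w • val m))
    (u : Tm (Word A (suc (suc n)))) (r : Tm (Red u)) : Tm (eval (delete u r) ≈ eval u) :=
  ind_sum r (fun r => eval (delete u r) ≈ eval u)
    (fun e => coe (cancel e (eval (init (init u)))))
    (fun r => coe (rec · init u · r · last u)).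
Definition eval_initdelete_ : Tm (Π A : univ 0, Π n : N, Π w : Word A (suc n), Π r : Initred w,
    Π m : Letter A, eval (initdelete w r m) ≈ eval w • val m) :=
  λ A, λ n, ind_nat (fun n => Π w : Word A (suc n), Π r : Initred w, Π m : Letter A,
                       eval (initdelete w r m) ≈ eval w • val m)
    (λ w, λ r, λ m, absurd (coe r))
    (fun n rec => λ w, λ r, λ m, coe (eval_delete_with rec w (coe r) ⋆ val m)) n.
Definition eval_initdelete {A : Set0} {n : Tm N} (w : Tm (Word A (suc n))) (r : Tm (Initred w))
    (m : Tm (Letter A)) : Tm (eval (initdelete w r m) ≈ eval w • val m) :=
  named "eval_initdelete" eval_initdelete_ · A · n · w · r · m.
Definition eval_delete_ : Tm (Π A : univ 0, Π n : N, Π u : Word A (suc (suc n)), Π r : Red u,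
    eval (delete u r) ≈ eval u) :=
  λ A, λ n, λ u, λ r, eval_delete_with (named "eval_initdelete" eval_initdelete_ · A · n) u r.
Definition eval_delete {A : Set0} {n : Tm N} (u : Tm (Word A (suc (suc n)))) (r : Tm (Red u)) :
    Tm (eval (delete u r) ≈ eval u) := named "eval_delete" eval_delete_ · A · n · u · r.

(** Since the path travels with the word, an equality in a fibre includes the agreement of the paths
    after deletion. *)
Definition Fib (A : Set0) (n : Tm N) (z : Tm (F A)) : Ty := Σ v : Word A n, eval v ≈ z.
Definition fib {A : Set0} {n : Tm N} {z : Tm (F A)} (v : Tm (Word A n)) (q : Tm (eval v ≈ z)) :
    Tm (Fib A n z) := ⟨v, q⟩.
Definition word {A : Set0} {n : Tm N} {z : Tm (F A)} (x : Tm (Fib A n z)) : Tm (Word A n) := fst x.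
Definition wpath {A : Set0} {n : Tm N} {z : Tm (F A)} (x : Tm (Fib A n z)) :
  Tm (eval (word x) ≈ z) := snd x.

Definition reduce_ : Tm (Π A : univ 0, Π n : N, Π z : F A, Π x : Fib A (suc (suc n)) z,
    Red (word x) ⇒ Fib A n z) :=
  λ A, λ n, λ z, λ x, λ r, fib (delete (word x) r) (eval_delete (word x) r • wpath x).
Definition reduce {A : Set0} {n : Tm N} {z : Tm (F A)} (x : Tm (Fib A (suc (suc n)) z))
    (r : Tm (Red (word x))) : Tm (Fib A n z) := named "reduce" reduce_ · A · n · z · x · r.

Definition Joined {A : Set0} {n : Tm N} {z : Tm (F A)} (x y : Tm (Fib A (suc (suc n)) z)) : Ty :=
  Σ r : Red (word x), Σ s : Red (word y), reduce x r ≈ reduce y s.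
(** Words of length 0 or 1 admit no deletion. Recursion in steps of two makes [Joinable] at length
    [n + 2] convertible to [Joined]. *)
Definition joinable_ : Tm (Π A : univ 0, Π n : N, Π z : F A, Fib A n z ⇒ Fib A n z ⇒ univ 0) :=
  λ A, λ n, ind2 (fun n => Π z : F A, Fib A n z ⇒ Fib A n z ⇒ univ 0)
    (λ z, λ x, λ y, code Empty) (λ z, λ x, λ y, code Empty)
    (fun n _ => λ z, λ x, λ y, code (Joined x y)) n.
Definition Joinable {A : Set0} {n : Tm N} {z : Tm (F A)} (x y : Tm (Fib A n z)) : Ty :=
  El (named "joinable" joinable_ · A · n · z · x · y).
Definition Conf {A : Set0} {n : Tm N} {z : Tm (F A)} (x y : Tm (Fib A n z)) : Ty :=
  sum (x ≈ y) (Joinable x y).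

(** * Local confluence *)

Definition fib_eq {A : Set0} {n : Tm N} {z : Tm (F A)} (v : Tm (Word A n)) {p q : Tm (eval v ≈ z)}
    (h : Tm (p ≈ q)) : Tm (fib v p ≈ fib v q) := ap (fun q => fib v q) h.

Definition joinable_sym_ : Tm (Π A : univ 0, Π n : N, Π z : F A, Π x : Fib A n z, Π y : Fib A n z,
    Joinable x y ⇒ Joinable y x) :=
  λ A, λ n, ind2 (fun n => Π z : F A, Π x : Fib A n z, Π y : Fib A n z, Joinable x y ⇒ Joinable y x)
    (λ z, λ x, λ y, λ j, absurd (coe j)) (λ z, λ x, λ y, λ j, absurd (coe j))
    (fun n _ => λ z, λ x, λ y, λ j,
      let j : Tm (Joined x y) := coe j in
      coe (⟨fst (snd j), ⟨fst j, (snd (snd j))^⟩⟩ : Tm (Joined y x))) n.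
Definition conf_sym_ : Tm (Π A : univ 0, Π n : N, Π z : F A, Π x : Fib A n z, Π y : Fib A n z,
    Conf x y ⇒ Conf y x) :=
  λ A, λ n, λ z, λ x, λ y, λ c,
  ind_sum c (fun _ => Conf y x) (fun p => in_l (p^))
    (fun j => in_r (named "joinable_sym" joinable_sym_ · A · n · z · x · y · j)).
Definition conf_sym {A : Set0} {n : Tm N} {z : Tm (F A)} {x y : Tm (Fib A n z)} (c : Tm (Conf x y)) :
    Tm (Conf y x) := named "conf_sym" conf_sym_ · A · n · z · x · y · c.

Definition fib_snoc {A : Set0} {n : Tm N} {z : Tm (F A)} (x : Tm (Fib A n z)) (m : Tm (Letter A)) :
    Tm (Fib A (suc n) (z • val m)) := fib (snoc (word x) m) (coe (wpath x ⋆ val m)).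

(** A deletion remains one after a letter is appended, and the words agree by computation. On paths
    the claim is that whiskering respects concatenation. *)
Definition reduce_snoc_ : Tm (Π A : univ 0, Π n : N, Π z : F A, Π x : Fib A (suc (suc n)) z,
    Π r : Red (word x), Π m : Letter A,
    reduce (fib_snoc x m) (in_r (coe r)) ≈ fib_snoc (reduce x r) m) :=
  λ A, λ n, λ z, λ x, λ r, λ m,
  coe (fib_eq (snoc (delete (word x) r) m)
    (coe (named "ap_concat" ap_concat_ · F A · F A · (λ p, p • val m) · eval (delete (word x) r) ·
            eval (word x) · z · eval_delete (word x) r · wpath x)
     : Tm ((coe (eval_delete (word x) r ⋆ val m) : Tm (_ ≈ eval (snoc (word x) m)))
             • (coe (wpath x ⋆ val m) : Tm (_ ≈ z • val m)) ≈
           coe ((eval_delete (word x) r • wpath x) ⋆ val m)))).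
Definition joinable_snoc_ : Tm (Π A : univ 0, Π n : N, Π z : F A, Π x : Fib A n z, Π y : Fib A n z,
    Π m : Letter A, Joinable x y ⇒ Joinable (fib_snoc x m) (fib_snoc y m)) :=
  λ A, λ n, ind2 (fun n => Π z : F A, Π x : Fib A n z, Π y : Fib A n z, Π m : Letter A,
                    Joinable x y ⇒ Joinable (fib_snoc x m) (fib_snoc y m))
    (λ z, λ x, λ y, λ m, λ j, absurd (coe j)) (λ z, λ x, λ y, λ m, λ j, absurd (coe j))
    (fun n _ => λ z, λ x, λ y, λ m, λ j,
      let j : Tm (Joined x y) := coe j in
      let rs := named "reduce_snoc" reduce_snoc_ in
      coe (⟨in_r (coe (fst j)), ⟨in_r (coe (fst (snd j))),
              (rs · A · n · z · x · fst j · m) •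
              ap (fun x => fib_snoc x m) (snd (snd j)) •
              (rs · A · n · z · y · fst (snd j) · m)^⟩⟩
           : Tm (Joined (fib_snoc x m) (fib_snoc y m)))) n.
Definition conf_snoc_ : Tm (Π A : univ 0, Π n : N, Π z : F A, Π x : Fib A n z, Π y : Fib A n z,
    Π m : Letter A, Conf x y ⇒ Conf (fib_snoc x m) (fib_snoc y m)) :=
  λ A, λ n, λ z, λ x, λ y, λ m, λ c,
  ind_sum c (fun _ => Conf (fib_snoc x m) (fib_snoc y m))
    (fun p => in_l (ap (fun x => fib_snoc x m) p))
    (fun j => in_r (named "joinable_snoc" joinable_snoc_ · A · n · z · x · y · m · j)).
Definition conf_snoc {A : Set0} {n : Tm N} {z : Tm (F A)} {x y : Tm (Fib A n z)}
    (m : Tm (Letter A)) (c : Tm (Conf x y)) : Tm (Conf (fib_snoc x m) (fib_snoc y m)) :=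
  named "conf_snoc" conf_snoc_ · A · n · z · x · y · m · c.

(* In [w k k^-1 k], deleting the first or the last two of the three letters gives
   the same word; that the paths agree is a triangle identity. *)
Definition Overlap {A : Set0} {n : Tm N} (w : Tm (Word A n)) (k l m : Tm (Letter A))
    (e : Tm (Matches k l)) (e' : Tm (Matches l m)) : Ty :=
  fib (z := eval w • val k • val l • val m) (snoc w k) (coe (cancel e' (eval (snoc w k)))) ≈
  fib (snoc w m) (coe (cancel e (eval w) ⋆ val m)).
Definition overlap_ : Tm (Π A : univ 0, Π n : N, Π w : Word A n, Π k : Letter A, Π l : Letter A,
    Π m : Letter A, Π e : Matches k l, Π e' : Matches l m, Overlap w k l m e e') :=
  λ A, λ n, λ w, λ k, λ l, λ m,
  let P k l m := Π e : Matches k l, Π e' : Matches l m, Overlap w k l m e e' in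
  ind_sum k (fun k => P k l m)
    (fun a => ind_sum l (fun l => P (in_l a) l m)
      (fun b => λ e, λ e', absurd (coe e))
      (fun b => ind_sum m (fun m => P (in_l a) (in_r b) m)
        (fun c => λ e, λ e',
          (* Induction on both matches turns the three letters into $a, a^{-1}, a$, where the claim
             is a triangle identity for [gen a]. *)
          ind_eq (fun b e => Π e' : b ≈ c, Overlap w (in_l a) (in_r b) (in_l c) (coe e) (coe e'))
            (λ e', ind_eq (fun c e' => Overlap w (in_l a) (in_r a) (in_l c) (coe (rfl a)) (coe e'))
               (coe (fib_eq (z := eval w • gen a • (gen a)^ • gen a) (snoc w (in_l a))
                  (coe (named "cancel_pVp" cancel_pVp_ · W A · pt A · pt A · pt A · gen a · eval w)
                   : Tm (coe (cVp (gen a) (eval w • gen a)) ≈ coe (cpV (gen a) (eval w) ⋆ gen a))))) e')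
            (coe e : Tm (a ≈ b)) · (coe e'))
        (fun c => λ e, λ e', absurd (coe e'))))
    (fun a => ind_sum l (fun l => P (in_r a) l m)
      (fun b => ind_sum m (fun m => P (in_r a) (in_l b) m)
        (fun c => λ e, λ e', absurd (coe e'))
        (fun c => λ e, λ e',
          ind_eq (fun b e => Π e' : b ≈ c, Overlap w (in_r a) (in_l b) (in_r c) (coe e) (coe e'))
            (λ e', ind_eq (fun c e' => Overlap w (in_r a) (in_l a) (in_r c) (coe (rfl a)) (coe e'))
               (coe (fib_eq (z := eval w • (gen a)^ • gen a • (gen a)^) (snoc w (in_r a))
                  (coe (named "cancel_VpV" cancel_VpV_ · W A · pt A · pt A · pt A · gen a · eval w)
                   : Tm (coe (cpV (gen a) (eval w • (gen a)^)) ≈ coe (cVp (gen a) (eval w) ⋆ (gen a)^))))) e')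
            (coe e : Tm (a ≈ b)) · (coe e')))
      (fun b => λ e, λ e', absurd (coe e))).

Definition at_end {A : Set0} {n : Tm N} (v : Tm (Word A n)) {l m : Tm (Letter A)}
    (e : Tm (Matches l m)) : Tm (Fib A n (eval v • val l • val m)) := fib v (cancel e (eval v)).

(** There is no judgmental eta for [Sigma], so [v] has to be split into its initial part and last
    letter before [overlap] applies. *)
Definition overlap_word_ : Tm (Π A : univ 0, Π n : N, Π v : Word A (suc n), Π l : Letter A,
    Π m : Letter A, Π e : Matches (last v) l, Π e' : Matches l m,
    at_end v e' ≈ fib (snoc (init v) m) (coe (cancel e (eval (init v)) ⋆ val m))) :=
  λ A, λ n, λ v, λ l, λ m,
  coe (ind_sigma (fun v : Tm (Σ w : Word A n, Letter A) =>
         let v : Tm (Word A (suc n)) := coe v in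
         Π e : Matches (last v) l, Π e' : Matches l m,
         at_end v e' ≈ fib (snoc (init v) m) (coe (cancel e (eval (init v)) ⋆ val m)))
    (fun w k => coe (named "overlap" overlap_ · A · n · w · coe k · l · m)) (coe v)).

Definition inside {A : Set0} {n : Tm N} (w : Tm (Word A (suc n))) (r : Tm (Initred w))
    (m : Tm (Letter A)) : Tm (Fib A n (eval w • val m)) :=
  fib (initdelete w r m) (eval_initdelete w r m).

(** Disjoint deletions commute, each being available after the other, and the paths agree by
    naturality of [cancel]. The induction is only a case split, after which [Initred v] is
    [Red v]. *)
Definition disjoint_ : Tm (Π A : univ 0, Π n : N, Π v : Word A (suc n), Π r : Initred v,
    Π l : Letter A, Π m : Letter A, Π e : Matches l m,
    Conf (at_end v e) (fib_snoc (inside v r l) m)) :=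
  λ A, λ n,
  ind_nat (fun n => Π v : Word A (suc n), Π r : Initred v, Π l : Letter A, Π m : Letter A,
             Π e : Matches l m, Conf (at_end v e) (fib_snoc (inside v r l) m))
    (λ v, λ r, λ l, λ m, λ e, absurd (coe r))
    (fun n _ => λ v, λ r, λ l, λ m, λ e,
      let r' : Tm (Red v) := coe r in
      in_r (coe (⟨coe r', ⟨in_l (coe e),
        coe (fib_eq (delete v r')
          (coe (named "cancel_nat" cancel_nat_ · A · l · m · e · eval (delete v r') · eval v ·
                  eval_delete v r')
           : Tm (eval_delete v r' • cancel e (eval v) ≈
                 cancel e (eval (delete v r')) • (eval_delete v r' ⋆ val l ⋆ val m))))⟩⟩
        : Tm (Joined (at_end v e) (fib_snoc (inside v r l) m))))) n.

(** The inner deletion either uses the last letter of [init u], so that it overlaps the one at the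
    end and the results are equal, or it lies further left and the two commute. *)
Definition end_inside_ : Tm (Π A : univ 0, Π n : N, Π u : Word A (suc (suc n)),
    Π e : Matches (last (init u)) (last u), Π r : Initred (init u),
    Conf (at_end (init (init u)) e) (coe (inside (init u) r (last u)))) :=
  λ A, λ n,
  ind_nat (fun n => Π u : Word A (suc (suc n)),
             Π e : Matches (last (init u)) (last u), Π r : Initred (init u),
             Conf (at_end (init (init u)) e) (coe (inside (init u) r (last u))))
    (λ u, λ e, λ r, absurd (coe r))
    (fun n _ => λ u, λ e, λ r,
      coe (ind_sum (coe r : Tm (Red (init u)))
        (fun r => Conf (at_end (init (init u)) e) (coe (inside (init u) (coe r) (last u))))
        (fun e' => in_l (coe (named "overlap_word" overlap_word_ · A · n · init (init u) ·
                           last (init u) · last u · e' · e)))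
        (fun r => coe (named "disjoint" disjoint_ · A · n · init (init u) · r · last (init u) ·
                         last u · e)))) n.

Definition step {A : Set0} {n : Tm N} (u : Tm (Word A (suc (suc n)))) (r : Tm (Red u)) :
    Tm (Fib A n (eval u)) := fib (delete u r) (eval_delete u r).

(** Two deletions at the end differ only in the witness of [Matches], which is unique because [A] is
    a set. One at the end and one inside are compared by [end_inside], two inside by recursion. *)
Definition conf_step_ : Tm (Π A : univ 0, Isset (El A) ⇒ Π n : N,
    (Π w : Word A (suc n), Π r : Initred w, Π s : Initred w, Π m : Letter A,
       Conf (inside w r m) (inside w s m)) ⇒
    Π u : Word A (suc (suc n)), Π r : Red u, Π s : Red u, Conf (step u r) (step u s)) :=
  λ A, λ h, λ n, λ rec, λ u, λ r, λ s,
  let ei := named "end_inside" end_inside_ · A · n · u in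
  ind_sum r (fun r => Conf (step u r) (step u s))
    (fun e => ind_sum s (fun s => Conf (step u (in_l e)) (step u s))
       (fun e' => in_l (ap (fun e => step u (in_l e))
                     (named "matches_prop" matches_prop_ · A · h · last (init u) · last u · e · e')))
       (fun s => coe (ei · e · s)))
    (fun r => ind_sum s (fun s => Conf (step u (in_r r)) (step u s))
       (fun e => coe (conf_sym (ei · e · r)))
       (fun s => coe (rec · init u · r · s · last u))).
Definition conf_inside_ : Tm (Π A : univ 0, Isset (El A) ⇒ Π n : N,
    Π w : Word A (suc n), Π r : Initred w, Π s : Initred w, Π m : Letter A,
    Conf (inside w r m) (inside w s m)) :=
  λ A, λ h, λ n,
  ind_nat (fun n => Π w : Word A (suc n), Π r : Initred w, Π s : Initred w, Π m : Letter A,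
             Conf (inside w r m) (inside w s m))
    (λ w, λ r, λ s, λ m, absurd (coe r))
    (fun n rec => λ w, λ r, λ s, λ m,
      coe (conf_snoc m (named "conf_step" conf_step_ · A · h · n · rec · w · coe r · coe s))) n.

(** Induction on the path of the fibre reduces to [z = eval u] with the reflexivity path, where
    [reduce] is convertible to [step]. *)
Definition conf_reduce_ : Tm (Π A : univ 0, Isset (El A) ⇒ Π n : N, Π z : F A,
    Π x : Fib A (suc (suc n)) z, Π r : Red (word x), Π s : Red (word x),
    Conf (reduce x r) (reduce x s)) :=
  λ A, λ h, λ n, λ z, λ x,
  ind_sigma (fun x : Tm (Fib A (suc (suc n)) z) => Π r : Red (word x), Π s : Red (word x),
               Conf (reduce x r) (reduce x s))
    (fun u q => ind_eq (fun z q => Π r : Red (word (fib u q)), Π s : Red (word (fib u q)),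
                          Conf (reduce (fib u q) r) (reduce (fib u q) s))
       (coe (named "conf_step" conf_step_ · A · h · n ·
               (named "conf_inside" conf_inside_ · A · h · n) · u))
       (coe q : Tm (eval u ≈ z))) x.

(** * Invariant predicates *)

Definition Iff (X Y : Ty) : Ty := Σ f : X ⇒ Y, Y ⇒ X.
Definition iff_prop {X Y : Ty} (hX : Tm (isprop X)) (hY : Tm (isprop Y)) : Tm (isprop (Iff X Y)) :=
  prod_prop (pi_prop (fun _ => hY)) (pi_prop (fun _ => hX)).

Definition Pred {A : Set0} (z : Tm (F A)) : Ty := Π n : N, Π u : Word A n, eval u ≈ z ⇒ hProp.
Definition Invariant {A : Set0} {z : Tm (F A)} (Φ : Tm (Pred z)) : Ty :=
  Π n : N, Π u : Word A (suc (suc n)), Π q : eval u ≈ z, Π r : Red u,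
  Iff (holds (Φ · suc (suc n) · u · q)) (holds (Φ · n · delete u r · (eval_delete u r • q))).
Definition invariant_prop_ : Tm (Π A : univ 0, Π z : F A, Π Φ : Pred z, isprop (Invariant Φ)) :=
  λ A, λ z, λ Φ, pi_prop (fun n => pi_prop (fun u => pi_prop (fun q => pi_prop (fun r =>
    iff_prop (holds_prop (Φ · suc (suc n) · u · q))
      (holds_prop (Φ · n · delete u r · (eval_delete u r • q))))))).

Definition inv_ : Tm (Π A : univ 0, F A ⇒ univ 1) :=
  λ A, λ z, code (Σ Φ : Pred z, Invariant Φ).
Definition Inv {A : Set0} (z : Tm (F A)) : Ty := El (named "inv" inv_ · A · z).
Definition pred {A : Set0} {z : Tm (F A)} (Φ : Tm (Inv z)) : Tm (Pred z) :=
  fst (coe Φ : Tm (Σ Φ : Pred z, Invariant Φ)).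
Definition invariant {A : Set0} {z : Tm (F A)} (Φ : Tm (Inv z)) : Tm (Invariant (pred Φ)) :=
  snd (coe Φ : Tm (Σ Φ : Pred z, Invariant Φ)).

Definition inv_ext_ : Tm (Π A : univ 0, Π z : F A, Π Φ : Inv z, Π Ψ : Inv z,
    (Π n : N, Π u : Word A n, Π q : eval u ≈ z, pred Φ · n · u · q ≈ pred Ψ · n · u · q) ⇒ Φ ≈ Ψ) :=
  λ A, λ z, λ Φ, λ Ψ, λ h,
  coe (subtype_eq (B := fun Φ : Tm (Pred z) => Invariant Φ)
    (fun Φ => named "invariant_prop" invariant_prop_ · A · z · Φ) (s := coe Φ) (t := coe Ψ)
    (fun_ext (fun n => fun_ext (fun u => fun_ext (fun q => h · n · u · q))))).

(** The new predicate reads [Φ] on words with [m] appended. A deletion in [u] is also one in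
    [snoc u m], and [ap_concat3] reconciles the two ways of composing the paths. *)
Definition shift_ : Tm (Π A : univ 0, Π y : F A, Π z : F A, Π m : Letter A, Π c : y • val m ≈ z,
    Inv z ⇒ Inv y) :=
  λ A, λ y, λ z, λ m, λ c, λ Φ,
  let Ψ : Tm (Pred y) := λ n, λ u, λ q, pred Φ · suc n · snoc u m · coe (q ⋆ val m • c) in
  coe (dpair (B := fun Ψ : Tm (Pred y) => Invariant Ψ) Ψ
    (λ n, λ u, λ q, λ r,
      let X := pred Φ · suc (suc (suc n)) · snoc u m · coe (q ⋆ val m • c) in
      coe (transport (fun p : Tm (eval (delete u r) • val m ≈ z) =>
             Iff (holds X) (holds (pred Φ · suc n · snoc (delete u r) m · coe p)))
        (coe (named "ap_concat3" ap_concat3_ · F A · F A · (λ p, p • val m) · eval (delete u r) ·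
                eval u · y · z · eval_delete u r · q · coe c)
         : Tm (eval_delete u r ⋆ val m • (q ⋆ val m • c) ≈ (eval_delete u r • q) ⋆ val m • c))
        (coe (invariant Φ · suc n · snoc u m · coe (q ⋆ val m • c) · in_r (coe r)))))).
Definition shift {A : Set0} {y z : Tm (F A)} (m : Tm (Letter A)) (c : Tm (y • val m ≈ z))
    (Φ : Tm (Inv z)) : Tm (Inv y) := named "shift" shift_ · A · y · z · m · c · Φ.

(** The double shift reads [Φ] on [u] followed by two inverse letters. Invariance deletes them, [h]
    identifies the remaining path with [q], and propositional extensionality yields an equality of
    predicates. *)
Definition shift_shift_ : Tm (Π A : univ 0, Π y : F A, Π z : F A, Π l : Letter A, Π m : Letter A,
    Π e : Matches l m, Π c : y • val l ≈ z, Π c' : z • val m ≈ y,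
    (Π p : F A, Π q : p ≈ y, cancel e p • ((q ⋆ val l • c) ⋆ val m • c') ≈ q) ⇒
    Π Φ : Inv y, shift l c (shift m c' Φ) ≈ Φ) :=
  λ A, λ y, λ z, λ l, λ m, λ e, λ c, λ c', λ h, λ Φ,
  named "inv_ext" inv_ext_ · A · y · shift l c (shift m c' Φ) · Φ · (λ n, λ u, λ q,
    let q' : Tm (eval (snoc (snoc u l) m) ≈ y) := coe ((q ⋆ val l • c) ⋆ val m • c') in
    let i : Tm (Iff (holds (pred Φ · suc (suc n) · snoc (snoc u l) m · q'))
                    (holds (pred Φ · n · u · (cancel e (eval u) • coe q')))) :=
      coe (invariant Φ · n · snoc (snoc u l) m · q' · in_l (coe e)) in
    coe (prop_ext (fst i) (snd i) • ap (fun q => pred Φ · n · u · q) (y := q) (coe (h · eval u · q)))).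

(** Moving forward along the loop of [a] means appending the inverse letter: if $u$ evaluates to $z
    \cdot a$, then $u a^{-1}$ evaluates to $z$. *)
Definition inv_equiv_ : Tm (Π A : univ 0, Π a : El A, Π z : F A, Equiv (Inv z) (Inv (z • gen a))) :=
  λ A, λ a, λ z,
  let push (Φ : Tm (Inv z)) : Tm (Inv (z • gen a)) := shift (in_r a) (coe ((cpV (gen a) z)^)) Φ in
  let pull (Φ : Tm (Inv (z • gen a))) : Tm (Inv z) := shift (in_l a) (coe (rfl (z • gen a))) Φ in
  mk_equiv (λ Φ, push Φ) (λ Φ, pull Φ)
    (coe (named "shift_shift" shift_shift_ · A · (z • gen a) · z · in_r a · in_l a ·
            coe (rfl a) · coe ((cpV (gen a) z)^) · coe (rfl (z • gen a)) ·
            coe (named "push_pull" push_pull_ · W A · pt A · pt A · pt A · gen a · z)))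
    (coe (named "shift_shift" shift_shift_ · A · z · (z • gen a) · in_l a · in_r a ·
            coe (rfl a) · coe (rfl (z • gen a)) · coe ((cpV (gen a) z)^) ·
            (λ p, λ q, coe (named "pull_push" pull_push_ · W A · pt A · pt A · pt A · gen a · p · z · q)))).

(** * The family over the wedge, null words and triviality of loops *)

Definition transport_family_ : Tm (Π A : univ 0, Π w : W A, Π q : pt A ≈ w,
    Π X : F A ⇒ univ 1, Π Y : pt A ≈ w ⇒ univ 1,
    (Π z : F A, X · z ≈ Y · (z • q)) ⇒ transport (fun w => pt A ≈ w ⇒ univ 1) q X ≈ Y) :=
  λ A, λ w, λ q, λ X,
  (* The loop is generalized to a path with free endpoint; at reflexivity, [z • q] is convertible to
     [z] and function extensionality remains. *)
  ind_eq (fun w q => Π Y : pt A ≈ w ⇒ univ 1, (Π z : F A, X · z ≈ Y · (z • q)) ⇒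
            transport (fun w => pt A ≈ w ⇒ univ 1) q X ≈ Y)
    (λ Y, λ h, coe (fun_ext (f := X) (g := Y) (fun z => coe (h · z)))) q.

Definition cover_ : Tm (Π A : univ 0, Π w : W A, pt A ≈ w ⇒ univ 1) :=
  λ A, λ w,
  let X : Tm (F A ⇒ univ 1) := named "inv" inv_ · A in
  prim indWedge [raw A; raw (fam (fun w : Tm (W A) => pt A ≈ w ⇒ univ 1)); raw X;
    raw (abs (A := El A) (fun a => named "transport_family" transport_family_ · A · pt A · gen a · X · X ·
           (λ z, named "ua1" (ua_ 1) · (X · z) · (X · (z • gen a)) ·
                   (coe (named "inv_equiv" inv_equiv_ · A · a · z))))); raw w].

(* [Null u q]: the path [q : eval u = 1] is merely obtained by deleting letters
   from [u] until nothing is left. *)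
Definition null_ : Tm (Π A : univ 0, Π n : N, Π u : Word A n, eval u ≈ rfl (pt A) ⇒ univ 0) :=
  λ A, λ n, ind2 (fun n => Π u : Word A n, eval u ≈ rfl (pt A) ⇒ univ 0)
    (λ u, λ q, code ((coe q : Tm (rfl (pt A) ≈ rfl (pt A))) ≈ rfl (rfl (pt A))))
    (λ u, λ q, code Empty)
    (fun n P => λ u, λ q, code (Σ r : Red u, Tr (El (P · delete u r · (eval_delete u r • q))))) n.
Definition Null {A : Set0} {n : Tm N} (u : Tm (Word A n)) (q : Tm (eval u ≈ rfl (pt A))) : Ty :=
  Tr (El (named "null" null_ · A · n · u · q)).
Definition NullF {A : Set0} {n : Tm N} (x : Tm (Fib A n (rfl (pt A)))) : Ty := Null (word x) (wpath x).

(** Nullity of [x] provides some deletion [s] with null result. By confluence this result is either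
    equal to that of [r] or joinable with it, and then [rec] applies at the smaller length. *)
Definition null_reduce_step_ : Tm (Π A : univ 0, Isset (El A) ⇒ Π n : N,
    (Π x : Fib A n (rfl (pt A)), Π y : Fib A n (rfl (pt A)), Joinable x y ⇒ NullF y ⇒ NullF x) ⇒
    Π x : Fib A (suc (suc n)) (rfl (pt A)), Π r : Red (word x), NullF x ⇒ NullF (reduce x r)) :=
  λ A, λ h, λ n, λ rec, λ x, λ r, λ t,
  trunc_rec (A := Σ s : Red (word x), NullF (reduce x s)) (trunc_prop _)
    (fun sy =>
      ind_sum (named "conf_reduce" conf_reduce_ · A · h · n · rfl (pt A) · x · r · fst sy)
        (fun _ => NullF (reduce x r))
        (fun p => transport (fun x => NullF x) (p^) (snd sy))
        (fun j => rec · reduce x r · reduce x (fst sy) · j · snd sy)) (coe t).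
(** Nullity passes from [y] down to the common reduct by [null_reduce_step], which needs only the
    claim two letters below, and from there up to [x] by definition. *)
Definition null_joinable_ : Tm (Π A : univ 0, Isset (El A) ⇒ Π n : N,
    Π x : Fib A n (rfl (pt A)), Π y : Fib A n (rfl (pt A)), Joinable x y ⇒ NullF y ⇒ NullF x) :=
  λ A, λ h, λ n, ind2 (fun n => Π x : Fib A n (rfl (pt A)), Π y : Fib A n (rfl (pt A)),
                         Joinable x y ⇒ NullF y ⇒ NullF x)
    (λ x, λ y, λ j, λ t, absurd (coe j)) (λ x, λ y, λ j, λ t, absurd (coe j))
    (fun n rec => λ x, λ y, λ j, λ t,
      let j : Tm (Joined x y) := coe j in
      coe (tr1 (dpair (B := fun r => NullF (reduce x r)) (fst j)
        (transport (fun x => NullF x) ((snd (snd j))^)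
          (named "null_reduce_step" null_reduce_step_ · A · h · n · rec · y · fst (snd j) · t))))) n.

Definition null_inv_ : Tm (Π A : univ 0, Isset (El A) ⇒ Inv (rfl (pt A))) :=
  λ A, λ h,
  let Φ : Tm (Pred (rfl (pt A))) := λ n, λ u, λ q,
    dpair (B := fun X : Tm (univ 0) => isprop (El X)) (code (Null u q)) (coe (trunc_prop (El (named "null" null_ · A · n · u · q)))) in
  coe (dpair (B := fun Φ : Tm (Pred (rfl (pt A))) => Invariant Φ) Φ
    (λ n, λ u, λ q, λ r,
      (* Confluence carries nullity along a deletion; in the other direction the deletion itself is
         the witness. *)
      coe (dpair (A := Null u q ⇒ Null (delete u r) (eval_delete u r • q))
                 (B := fun _ => Null (delete u r) (eval_delete u r • q) ⇒ Null u q)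
        (coe (named "null_reduce_step" null_reduce_step_ · A · h · n ·
                (named "null_joinable" null_joinable_ · A · h · n) · fib u q · coe r))
        (λ t, coe (tr1 (dpair (B := fun r => Null (delete u r) (eval_delete u r • q)) r t)))))).

Definition section_ : Tm (Π A : univ 0, Isset (El A) ⇒ Π w : W A, Π y : pt A ≈ w,
    El (named "cover" cover_ · A · w · y)) :=
  λ A, λ h, λ w, λ y,
  ind_eq (fun w y => El (named "cover" cover_ · A · w · y))
    (coe (named "null_inv" null_inv_ · A · h)) y.

(* The predicate at [z] holds of the empty word and [q : 1 = z] for all [z], by
   path induction; at [z = 1] it is [Null]. *)
Definition loop_trivial_ : Tm (Π A : univ 0, Isset (El A) ⇒ Π p : rfl (pt A) ≈ rfl (pt A),
    Tr (p ≈ rfl (rfl (pt A)))) :=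
  λ A, λ h, λ p,
  let s (z : Tm (F A)) : Tm (Inv z) := coe (named "section" section_ · A · h · pt A · z) in
  coe (ind_eq (fun z q => holds (pred (s z) · zer · coe tt · coe q))
         (coe (tr1 (rfl (rfl (rfl (pt A)))))) p).

(** The free endpoint [w] lets path induction reduce an arbitrary base point [x] to [rfl (pt A)]. *)
Definition loops_trivial_ : Tm (Π A : univ 0, Isset (El A) ⇒ Π w : W A, Π x : pt A ≈ w, Π p : x ≈ x,
    Tr (p ≈ rfl x)) :=
  λ A, λ h, λ w, λ x,
  ind_eq (fun w x => Π p : x ≈ x, Tr (p ≈ rfl x)) (named "loop_trivial" loop_trivial_ · A · h) x.

(** * The fundamental group *)

Definition Tr0 (A : Ty) : Ty := prim (Trunc 2) [raw A].
Definition tr0 {A : Ty} (a : Tm A) : Tm (Tr0 A) := prim (tr 2) [raw A; raw a].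
Definition trunc_set_ : Tm (Π A : type, Π x : Tr0 A, Π y : Tr0 A, isprop (x ≈ y)) :=
  λ A, λ x, λ y, λ p, λ q,
  fst ((prim (istrunc 2) [raw A] : Tm (Isset (Tr0 A))) · x · y · p · q).
Definition trunc_set {A : Ty} (x y : Tm (Tr0 A)) : Tm (isprop (x ≈ y)) :=
  named "trunc_set" trunc_set_ · A · x · y.

Definition fundgroup_trivial_ : Tm (Π A : univ 0, Isset (El A) ⇒ Π x : F A,
    Equiv (Tr0 (x ≈ x)) Unit) :=
  λ A, λ h, λ x,
  let P (t : Tm (Tr0 (x ≈ x))) : Ty := tr0 (rfl x) ≈ t in
  mk_equiv (λ t, tt) (λ u, tr0 (rfl x))
    (λ u, coe (prim (A := cU) indOne [raw (fam (fun u : Tm Unit => tt ≈ u)); raw (rfl tt); raw u]))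
    (λ t, coe (prim (A := cU) (indTrunc 2) [raw (x ≈ x); raw (fam P);
      raw (abs (A := Tr0 (x ≈ x)) (B := fun t => Isset (P t)) (fun t =>
             λ p, λ q, prop_hlevel (λ r, λ s, prop_set (trunc_set (tr0 (rfl x)) t) r s)));
      raw (abs (A := x ≈ x) (B := fun p => P (tr0 p)) (fun p =>
             (* Path types of a set-truncation are propositions, so it suffices that [p] is merely
                equal to [rfl x]. *)
             trunc_rec (trunc_set (tr0 (rfl x)) (tr0 p)) (fun e => ap (fun p => tr0 p) (e^))
               (named "loops_trivial" loops_trivial_ · A · h · pt A · x · p)));
      raw t])).

(** Reversed, because an entry may refer only to those in the tail of the table. *)
Definition library : table := rev [
  entry "proj1" proj1_;
  entry "proj2" proj2_;
  entry "concat" concat_;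
  entry "inverse" inverse_;
  entry "ap" ap_;
  entry "transport" transport_;
  entry "concat_1p" concat_1p_;
  entry "ap_concat" ap_concat_;
  entry "ap_concat3" ap_concat3_;
  entry "cancel_pV" cancel_pV_;
  entry "cancel_Vp" cancel_Vp_;
  entry "cancel_pVp" cancel_pVp_;
  entry "cancel_VpV" cancel_VpV_;
  entry "pull_push" pull_push_;
  entry "push_pull" push_pull_;
  entry "equiv_inv" equiv_inv_;
  entry "funext" funext_;
  entry "ua0" (ua_ 0);
  entry "ua1" (ua_ 1);
  entry "pi_prop" pi_prop_;
  entry "prod_prop" prod_prop_;
  entry "concat_Vp" concat_Vp_;
  entry "prop_set" prop_set_;
  entry "isprop_isprop" isprop_isprop_;
  entry "subtype" subtype_;
  entry "prop_ext" prop_ext_;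
  entry "trunc_prop" trunc_prop_;
  entry "trunc_rec" trunc_rec_;
  entry "ind2" ind2_;
  entry "matches" matches_;
  entry "val" val_;
  entry "matches_prop" matches_prop_;
  entry "cancel" cancel_;
  entry "cancel_nat" cancel_nat_;
  entry "word_type" word_type_;
  entry "eval" eval_;
  entry "initred" initred_;
  entry "initdelete" initdelete_;
  entry "delete" delete_;
  entry "eval_initdelete" eval_initdelete_;
  entry "eval_delete" eval_delete_;
  entry "reduce" reduce_;
  entry "joinable" joinable_;
  entry "joinable_sym" joinable_sym_;
  entry "conf_sym" conf_sym_;
  entry "reduce_snoc" reduce_snoc_;
  entry "joinable_snoc" joinable_snoc_;
  entry "conf_snoc" conf_snoc_;
  entry "overlap" overlap_;
  entry "overlap_word" overlap_word_;
  entry "disjoint" disjoint_;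
  entry "end_inside" end_inside_;
  entry "conf_step" conf_step_;
  entry "conf_inside" conf_inside_;
  entry "conf_reduce" conf_reduce_;
  entry "invariant_prop" invariant_prop_;
  entry "inv" inv_;
  entry "inv_ext" inv_ext_;
  entry "shift" shift_;
  entry "shift_shift" shift_shift_;
  entry "inv_equiv" inv_equiv_;
  entry "transport_family" transport_family_;
  entry "cover" cover_;
  entry "null" null_;
  entry "null_reduce_step" null_reduce_step_;
  entry "null_joinable" null_joinable_;
  entry "null_inv" null_inv_;
  entry "section" section_;
  entry "loop_trivial" loop_trivial_;
  entry "loops_trivial" loops_trivial_;
  entry "trunc_set" trunc_set_;
  entry "fundgroup_trivial" fundgroup_trivial_
].

(** The type of each entry is checked against the entries after it, hence the order. [univalence]
    occurs at level 0 for [hProp] and at level 1 for [Inv]. *)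
Definition levels : list (cst * nat * nat) :=
  map (fun c => (c, 3, 3))
    [indWedge; loop; base; indTrunc 1; indTrunc 2; istrunc 1; istrunc 2; tr 1; tr 2; funext] ++
  [(univalence, 0, 0); (univalence, 1, 0)] ++
  map (fun c => (c, 3, 3))
    [indSigma; pair; J; refl; indSum; inl; inr; indNat; succ; zero; indOne; star; indZero;
     Nat; One; Zero; Sigma].

End Terms.

Local Open Scope hott_scope.

Theorem theorem7p2 (i : nat) :
  provable (Π A : U i, isset A ⇒ Π x : freegroup A,
              equiv (fundgroup (freegroup A) x) One).
Proof.
  (* The checker is run by evaluation; 1000 is its fuel, and soundness holds for any amount. *)
  assert (HK : check_consts 1000 Terms.levels = true) by (vm_compute; reflexivity).
  assert (HT : check_table 1000 Terms.levels Terms.library = true) by (vm_compute; reflexivity).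
  destruct (check_table_provable 1000 Terms.levels Terms.library "fundgroup_trivial"
              _ _ HK HT eq_refl) as [t Ht].
  (* The library has [A : U 0]; the universe shift moves the derivation to [U i]. *)
  apply (typing_lvl i) in Ht. exists (lvl i t).
  replace (closed _) with (lvl i (closed (Π A : U 0, isset A ⇒ Π x : freegroup A,
                                   equiv (fundgroup (freegroup A) x) One))).
  (* The erased type of the table entry computes to the statement for [U 0]. *)
  - exact Ht.
  - cbn -[Nat.add]. rewrite Nat.add_0_r. reflexivity.
Qed.
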